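(* (Hyponormality of polynomial Toeplitz pairs) Let $\Phi,\Psi\in L^\infty_{M_n}$ be matrix-valued trigonometric polynomials of the form $$\Phi(z):=\sum_{j=-m}^NA_jz^j\quad\text{and}\quad\Psi(z):=\sum_{j=-\ell}^MB_jz^j$$ satisfying (i) the outer coefficients $A_{-m},A_N,B_{-\ell}$ and $B_M$ are invertible; (ii) the co-analytic outer coefficients $A_{-m}$ and $B_{-\ell}$ are diagonal-constant. If $\mathbf T\equiv(T_\Phi,T_\Psi)$ is hyponormal, then $$\Phi-\Lambda\Psi\in H^2_{M_n}\quad\text{for some constant matrix }\Lambda\in M_n.$$
   Context: $M_n$ is the algebra of complex $n\times n$ matrices and $A_j,B_j\in M_n$. $L^\infty_{M_n}$ is the set of bounded measurable $M_n$-valued functions on the unit circle. For a matrix-valued trigonometric polynomial $\sum_{j=-m}^N A_jz^j$, the coefficients $A_N$ and $A_{-m}$ are called its outer coefficients. A matrix is diagonal-constant if it is diagonal and constant along the diagonal, i.e., a scalar multiple of the identity. $H^2_{M_n}$ is the set of $n\times n$ matrix functions with entries in the Hardy space $H^2$ of the unit circle. $T_\Phi f=P_n(\Phi f)$ is the block Toeplitz operator on the $\mathbb C^n$-valued Hardy space $H^2_{\mathbb C^n}$, $P_n$ being the orthogonal projection of $L^2_{\mathbb C^n}$ onto $H^2_{\mathbb C^n}$. The pair $\mathbf T=(T_1,T_2)$ is (jointly) hyponormal if $\begin{pmatrix}[T_1^*,T_1]&[T_2^*,T_1]\\ [T_1^*,T_2]&[T_2^*,T_2]\end{pmatrix}\ge0$,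 where $[S,T]=ST-TS$.
   Formalization: The degree ℓ is assumed to be at least 1, so that B_{-ℓ} is genuinely co-analytic; for ℓ = 0 the claim fails (n = 1, Φ = z^{-1} + 2z, Ψ = 1), except when m = 0 too, where Λ = 0 works trivially. *)

(* Defs.v *)
From HB Require Import structures.
From mathcomp Require Import all_boot all_order all_algebra.
From mathcomp Require Import complex.
From mathcomp Require Import all_classical all_reals all_analysis.

Set Implicit Arguments.
Unset Strict Implicit.
Unset Printing Implicit Defensive.

Import Order.TTheory GRing.Theory Num.Theory.
Local Open Scope classical_set_scope.
Local Open Scope ring_scope.
Local Open Scope complex_scope.

(* A function on the unit circle is a total function on R[i]; only its values
   at the points circle t with t in [0, 2 pi] are ever used.  Elements of L^2
   are represented by functions, with no quotient by a.e. equality: everything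
   below depends on such a representative only through its a.e. class. *)

Section Circle.
Variable R : realType.

Definition circle (t : R) : R[i] := cos t +i* sin t.

Definition angles : set R := `[0, pi *+ 2]%classic.

Definition circle_integral (f : R[i] -> R[i]) : R[i] :=
  ((pi *+ 2)^-1)%:C *
  ((\int[lebesgue_measure]_(t in angles) complex.Re (f (circle t))) +i*
   (\int[lebesgue_measure]_(t in angles) complex.Im (f (circle t)))).

Definition L2 (f : R[i] -> R[i]) : Prop :=
  [/\ measurable_fun angles (fun t => complex.Re (f (circle t))),
      measurable_fun angles (fun t => complex.Im (f (circle t))) &
      (@lebesgue_measure R).-integrable angles
        (fun t => (complex.Re (f (circle t)) ^+ 2 +
                   complex.Im (f (circle t)) ^+ 2)%:E)].

Definition fourier (f : R[i] -> R[i]) (k : int) : R[i] :=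
  circle_integral (fun z => f z * z ^ (- k)).

Definition H2 (f : R[i] -> R[i]) : Prop :=
  L2 f /\ forall k : int, k < 0 -> fourier f k = 0.

Definition H2mx (n : nat) (F : R[i] -> 'M[R[i]]_n) : Prop :=
  forall i j, H2 (fun z => F z i j).

Section Block.
Variable n : nat.
Implicit Types f g h : R[i] -> 'cV[R[i]]_n.

Definition H2vec f : Prop := forall i, H2 (fun z => f z i 0).

Definition inner f g : R[i] :=
  circle_integral (fun z => \sum_(i < n) f z i 0 * (g z i 0)^*).

(* Meaningful for f in L^2; [xget] picks a representative of the a.e. class. *)
Definition proj f : R[i] -> 'cV[R[i]]_n :=
  xget (fun=> 0)
    [set g | H2vec g /\ forall h, H2vec h -> inner (f \- g) h = 0].

Definition toeplitz (F : R[i] -> 'M[R[i]]_n) f : R[i] -> 'cV[R[i]]_n :=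
  proj (fun z => F z *m f z).

Implicit Types S T : (R[i] -> 'cV[R[i]]_n) -> (R[i] -> 'cV[R[i]]_n).

(* Hilbert space adjoint of an operator on H^2. *)
Definition adjoint T f : R[i] -> 'cV[R[i]]_n :=
  xget (fun=> 0)
    [set g | H2vec g /\ forall h, H2vec h -> inner (T h) f = inner h g].

Definition commutator S T f : R[i] -> 'cV[R[i]]_n := S (T f) \- T (S f).

Definition hyponormal_pair T1 T2 : Prop :=
  forall f1 f2, H2vec f1 -> H2vec f2 ->
    0 <= inner (commutator (adjoint T1) T1 f1 \+ commutator (adjoint T2) T1 f2)
               f1
       + inner (commutator (adjoint T1) T2 f1 \+ commutator (adjoint T2) T2 f2)
               f2.

(* The trigonometric polynomial \sum_(- m <= j <= N) A_j z^j. *)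
Definition trig_poly (m N : nat) (A : int -> 'M[R[i]]_n) (z : R[i]) :
    'M[R[i]]_n :=
  \sum_(0 <= k < (m + N).+1) z ^ (k%:Z - m%:Z) *: A (k%:Z - m%:Z).

End Block.
End Circle.

(* Main.v *)
Require Import Defs.
From mathcomp Require Import all_boot all_order all_algebra.
From mathcomp Require Import complex ring lra zify.
From mathcomp Require Import all_classical all_reals all_analysis.
From mathcomp Require Import measurable_realfun.
Import Order.TTheory GRing.Theory Num.Theory.
Import numFieldNormedType.Exports.
Set Implicit Arguments.
Unset Strict Implicit.
Unset Printing Implicit Defensive.
Local Open Scope complex_scope.
Local Open Scope ring_scope.

(** On the circle write Phi_i = z^-L G_i and Phi_i^* = z^-K D_i, where G_i and D_i
    are matrices of polynomials (here i = 1, 2 stand for Phi and Psi), L is the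
    largest co-analytic degree and K the largest analytic degree; thus D_i(0)
    is the conjugate transpose of the coefficient of z^K in Phi_i.  For a
    polynomial vector f, the Toeplitz operator keeps the coefficients of G_i f
    of index at least L ([hi L]), and the remaining ones ([lo L]) form the
    Hankel part H_i f; likewise the adjoint of T_i keeps [hi K (D_i f)] and
    leaves a Hankel part K_i f.  So the hyponormality form at (f1, f2) is
      N(f1, f2) - sum_(i,j) <H_i f_j, H_j f_i> + |K_1 f1 + K_2 f2|^2,
    where N is the form of the matrix function with blocks [Phi_j^*, Phi_i].

    Normality: multiplying f1 and f2 by a large power of z leaves N unchanged
    and makes all Hankel parts vanish, so N >= 0.  A commutator has trace zero,
    so N vanishes on every (e_s, 0) and (0, e_s), and then everywhere, being a
    positive form compatible with multiplication by polynomials.  What is left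
    of hyponormality is the inequality
      sum_(i,j) <H_i f_j, H_j f_i> <= |K_1 f1 + K_2 f2|^2    ([hankel_ineq]),
    obtained in [hyponormal_pair_hankel_ineq].

    This inequality survives the replacement of Phi_1 by Phi_1 - c Phi_2 for a
    scalar c ([hankel_ineq_sub]).  Since the co-analytic outer coefficients are
    scalar matrices, c can be chosen to cancel the coefficient of z^-L in
    Phi_1 (when Psi has the larger co-analytic degree; the opposite case is
    contradictory).  Then the whole co-analytic part of Phi_1 vanishes
    ([hankel_ineq_coef_eq0]): as one of D_1(0), D_2(0) is invertible, the
    equation D_1 f1 + D_2 f2 = 0 can be solved modulo z^K, which makes the right
    side zero, with f1 and f2 divisible by a power of z that cancels all terms
    of the left side except one or two squares.  These squares must be zero,
    against the invertibility of G_2(0) or the choice of f1.  Hence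
    Lambda = c works.

    On the analytic side, projections, adjoints and Toeplitz operators are known
    only through their defining properties.  Existence comes from the backward
    shift: if g is the projection of u, then (g - g(0)) / z is that of u / z
    ([is_proj_mulVz]).  This applies to Phi f for every f in H^2, because z^L Phi f
    is in H^2; the adjoint of T_Phi is the Toeplitz operator of Phi^*, by
    uniqueness. *)

(** * The coefficient inner product of polynomial vectors *)

Section CoefficientProduct.
Variable C : numClosedFieldType.
Implicit Types (c : C) (p q r : {poly C}).

Definition pdot p q : C := \sum_(i < size p) p`_i * (q`_i)^*.

Lemma pdotE B p q : (size p <= B)%N -> pdot p q = \sum_(i < B) p`_i * (q`_i)^*.
Proof.
move=> pB; rewrite /pdot (big_ord_widen B (fun i => p`_i * (q`_i)^*) pB) big_mkcond /=.
by apply: eq_bigr => i _; case: ltnP => // /(nth_default 0) ->; rewrite mul0r.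
Qed.

Lemma pdot_conj p q : (pdot p q)^* = pdot q p.
Proof.
rewrite (pdotE _ (leq_maxl (size p) (size q))) (pdotE _ (leq_maxr (size p) (size q))).
by rewrite rmorph_sum; apply: eq_bigr => i _; rewrite rmorphM /= conjCK mulrC.
Qed.

Lemma pdotDl p q r : pdot (p + q) r = pdot p r + pdot q r.
Proof.
rewrite (pdotE _ (size_polyD p q)) (pdotE _ (leq_maxl (size p) (size q))).
rewrite (pdotE _ (leq_maxr (size p) (size q))) -big_split /=.
by apply: eq_bigr => i _; rewrite coefD mulrDl.
Qed.

Lemma pdotZl c p q : pdot (c *: p) q = c * pdot p q.
Proof.
rewrite (pdotE _ (size_scale_leq c p)) mulr_sumr.
by apply: eq_bigr => i _; rewrite coefZ mulrA.
Qed.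

Lemma pdot_mulX p q : pdot ('X * p) ('X * q) = pdot p q.
Proof.
have le : (size ('X * p)%R <= (size p).+1)%N.
  by rewrite (leq_trans (size_polyMleq _ _))// size_polyX.
rewrite (pdotE _ le) big_ord_recl !coefXM /= mul0r add0r.
by apply: eq_bigr => i _; rewrite !coefXM.
Qed.

Lemma pdot_take_drop k p q : pdot p q =
  pdot (take_poly k p) (take_poly k q) + pdot (drop_poly k p) (drop_poly k q).
Proof.
rewrite (pdotE _ (leq_addl k (size p))) big_split_ord /=; congr (_ + _).
  rewrite (pdotE _ (size_take_poly k p)); apply: eq_bigr => i _.
  by rewrite !coef_take_poly ltn_ord.
have le : (size (drop_poly k p) <= size p)%N by rewrite size_drop_poly leq_subr.
by rewrite (pdotE _ le); apply: eq_bigr => i _; rewrite !coef_drop_poly addnC.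
Qed.

Lemma pdot_ge0 p : 0 <= pdot p p.
Proof. by apply: sumr_ge0 => i _; exact: mul_conjC_ge0. Qed.

Lemma pdot_eq0 p : pdot p p = 0 -> p = 0.
Proof.
move=> /eqP; rewrite psumr_eq0 => [/allP p0|i _]; last exact: mul_conjC_ge0.
apply/polyP => i; rewrite coef0; case: (ltnP i (size p)) => ip; last exact: nth_default.
have := p0 (Ordinal ip); rewrite mem_index_enum mul_conjC_eq0 => /(_ isT) /=.
by move/eqP.
Qed.

Variable n : nat.
Implicit Types (u v w : 'cV[{poly C}]_n).

Definition vdot u v : C := \sum_s pdot (u s 0) (v s 0).
Definition lo k u : 'cV[{poly C}]_n := map_mx (take_poly k) u.
Definition hi k u : 'cV[{poly C}]_n := map_mx (drop_poly k) u.

Lemma vdot_conj u v : (vdot u v)^* = vdot v u.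
Proof. by rewrite rmorph_sum; apply: eq_bigr => i _; exact: pdot_conj. Qed.

Lemma vdotDl u v w : vdot (u + v) w = vdot u w + vdot v w.
Proof. by rewrite -big_split; apply: eq_bigr => i _; rewrite mxE pdotDl. Qed.

Lemma vdotDr u v w : vdot w (u + v) = vdot w u + vdot w v.
Proof. by rewrite -vdot_conj vdotDl rmorphD /= !vdot_conj. Qed.

Lemma vdotZl c u v : vdot (c%:P *: u) v = c * vdot u v.
Proof.
by rewrite mulr_sumr; apply: eq_bigr => i _; rewrite mxE mul_polyC pdotZl.
Qed.

Lemma vdotZr c u v : vdot u (c%:P *: v) = c^* * vdot u v.
Proof. by rewrite -vdot_conj vdotZl rmorphM /= vdot_conj. Qed.

Lemma vdotNl u v : vdot (- u) v = - vdot u v.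
Proof. by rewrite -scaleN1r -[-1]/(- 1%:P) -polyCN vdotZl mulN1r. Qed.

Lemma vdotNr u v : vdot u (- v) = - vdot u v.
Proof. by rewrite -vdot_conj vdotNl rmorphN /= vdot_conj. Qed.

Lemma vdot0l u : vdot 0 u = 0.
Proof. by rewrite -[0 in LHS](scale0r u) -polyC0 vdotZl mul0r. Qed.

Lemma vdot0r u : vdot u 0 = 0.
Proof. by rewrite -vdot_conj vdot0l rmorph0. Qed.

Lemma vdot_mulX u v : vdot ('X *: u) ('X *: v) = vdot u v.
Proof. by apply: eq_bigr => i _; rewrite !mxE pdot_mulX. Qed.

Lemma vdot_mulXn k u v : vdot ('X^k *: u) ('X^k *: v) = vdot u v.
Proof.
elim: k => [|k IH]; first by rewrite expr0 !scale1r.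
by rewrite exprS -!scalerA vdot_mulX.
Qed.

(** Analytic and Hankel parts are orthogonal. *)
Lemma vdot_lo_hi k u v : vdot u v = vdot (lo k u) (lo k v) + vdot (hi k u) (hi k v).
Proof.
rewrite -big_split /=; apply: eq_bigr => i _.
by rewrite !mxE [LHS](pdot_take_drop k).
Qed.

Lemma vdot_ge0 u : 0 <= vdot u u.
Proof. by apply: sumr_ge0 => i _; exact: pdot_ge0. Qed.

Lemma vdot_eq0 u : vdot u u = 0 -> u = 0.
Proof.
move=> /eqP; rewrite psumr_eq0 => [/allP u0|i _]; last exact: pdot_ge0.
apply/matrixP => i j; rewrite ord1 mxE; apply: pdot_eq0; apply/eqP.
exact: (u0 i (mem_index_enum _)).
Qed.

Lemma loD k u v : lo k (u + v) = lo k u + lo k v.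
Proof. exact: map_mxD. Qed.

Lemma loN k u : lo k (- u) = - lo k u.
Proof. exact: map_mxN. Qed.

Lemma loZ k c u : lo k (c%:P *: u) = c%:P *: lo k u.
Proof. by apply/matrixP => i j; rewrite !mxE !mul_polyC take_polyZ. Qed.

Lemma lo_mulXn k j u : (k <= j)%N -> lo k ('X^j *: u) = 0.
Proof.
move=> kj; apply/matrixP => i l; rewrite !mxE; apply/polyP => a.
rewrite coef_take_poly coef0 coefXnM; case: ifP => // ak.
by rewrite (leq_trans ak kj).
Qed.

End CoefficientProduct.

(** * Normality and the Hankel inequality *)

Section Pair.
Variables (C : numClosedFieldType) (n : nat).
Local Notation vec := 'cV[{poly C}]_n.
Local Notation mat := 'M[{poly C}]_n.
Implicit Types (u v p q : vec) (G D : mat) (x y : vec * vec).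

(** With Phi_i = z^-L G_i and Phi_i^* = z^-K D_i this reads
    sum_(i,j) <H_i p_j, H_j p_i> <= |K_1 p1 + K_2 p2|^2 for the Hankel parts
    H_i of Phi_i and K_i of Phi_i^*. *)
Definition hankel_ineq L K G1 G2 D1 D2 := forall p1 p2,
  vdot (lo L (G1 *m p1)) (lo L (G1 *m p1)) +
  vdot (lo L (G1 *m p2)) (lo L (G2 *m p1)) +
  vdot (lo L (G2 *m p1)) (lo L (G1 *m p2)) +
  vdot (lo L (G2 *m p2)) (lo L (G2 *m p2)) <=
  vdot (lo K (D1 *m p1 + D2 *m p2)) (lo K (D1 *m p1 + D2 *m p2)).

Section Normality.
Variables (L K : nat) (G1 G2 D1 D2 : mat).

Hypothesis toeplitz_ge0 : forall p1 p2,
  0 <= vdot (hi L (G1 *m p1)) (hi L (G1 *m p1)) +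
       vdot (hi L (G1 *m p2)) (hi L (G2 *m p1)) +
       vdot (hi L (G2 *m p1)) (hi L (G1 *m p2)) +
       vdot (hi L (G2 *m p2)) (hi L (G2 *m p2)) -
      (vdot (hi K (D1 *m p1)) (hi K (D1 *m p1)) +
       vdot (hi K (D2 *m p2)) (hi K (D1 *m p1)) +
       vdot (hi K (D1 *m p1)) (hi K (D2 *m p2)) +
       vdot (hi K (D2 *m p2)) (hi K (D2 *m p2))).

Let e s : vec := delta_mx s 0.

Hypothesis trace1 : \sum_s vdot (G1 *m e s) (G1 *m e s) =
                    \sum_s vdot (D1 *m e s) (D1 *m e s).
Hypothesis trace2 : \sum_s vdot (G2 *m e s) (G2 *m e s) =
                    \sum_s vdot (D2 *m e s) (D2 *m e s).

(** The form of the block matrix function with blocks [Phi_j^*, Phi_i]. *)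
Let N x : C :=
  vdot (G1 *m x.1) (G1 *m x.1) + vdot (G1 *m x.2) (G2 *m x.1) +
  vdot (G2 *m x.1) (G1 *m x.2) + vdot (G2 *m x.2) (G2 *m x.2) -
  (vdot (D1 *m x.1) (D1 *m x.1) + vdot (D2 *m x.2) (D1 *m x.1) +
   vdot (D1 *m x.1) (D2 *m x.2) + vdot (D2 *m x.2) (D2 *m x.2)).

Let N_mulX x : N ('X *: x) = N x.
Proof.
by case: x => p q; rewrite /N /= -!scalemxAr !vdot_mulX.
Qed.

(** A power of X beyond L and K moves everything into the analytic part. *)
Let N_ge0 x : 0 <= N x.
Proof.
have := toeplitz_ge0 ('X^(maxn L K) *: x.1) ('X^(maxn L K) *: x.2).
have E k u v : (k <= maxn L K)%N ->
    vdot (hi k ('X^(maxn L K) *: u)) (hi k ('X^(maxn L K) *: v)) = vdot u v.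
  move=> le; rewrite -[RHS](vdot_mulXn (maxn L K)) [RHS](vdot_lo_hi k).
  by rewrite lo_mulXn// vdot0l add0r.
by rewrite -!scalemxAr !E ?leq_maxl ?leq_maxr.
Qed.

Let N_parallelogram x y : N (x + y) + N (x - y) = N x *+ 2 + N y *+ 2.
Proof.
have par u v p q : vdot (u + p) (v + q) =
    vdot u v *+ 2 + vdot p q *+ 2 - vdot (u - p) (v - q).
  by rewrite !(vdotDl, vdotDr, vdotNl, vdotNr) !mulr2n; ring.
have parmx A B (i j : vec * vec -> vec) := par (A *m i x) (B *m j x) (A *m i y) (B *m j y).
rewrite /N /= !mulmxDr !mulmxN.
rewrite (parmx G1 G1 fst fst) (parmx G1 G2 snd fst) (parmx G2 G1 fst snd).
rewrite (parmx G2 G2 snd snd) (parmx D1 D1 fst fst) (parmx D2 D1 snd fst).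
rewrite (parmx D1 D2 fst snd) (parmx D2 D2 snd snd).
by do ?[move: (vdot _ _) => ?]; ring.
Qed.

(** Null vectors of a positive form are closed under sums: by the parallelogram
   law the values at x + y and x - y are opposite. *)
Let null_add x y : N x = 0 -> N y = 0 -> N (x + y) = 0.
Proof.
move=> Nx Ny; apply/le_anti; rewrite N_ge0 andbT.
have := N_parallelogram x y; rewrite Nx Ny !mul0rn addr0 => /eqP.
by rewrite addr_eq0 => /eqP ->; rewrite oppr_le0 N_ge0.
Qed.

Let null_scale (p : {poly C}) x : N x = 0 -> N (p *: x) = 0.
Proof.
move=> Nx; elim/poly_ind: p => [|p c IH].
  by rewrite scale0r /N /= !mulmx0 !vdot0l !addr0 subr0.
rewrite scalerDl; apply: null_add.
  by rewrite mulrC -scalerA N_mulX.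
case: x Nx {IH} => u v; rewrite /N /= => Nx.
rewrite -!scalemxAr !vdotZl !vdotZr -[RHS](mulr0 (c * c^*)) -Nx.
by do ?[move: (vdot _ _) => ?]; ring.
Qed.

(** The values N (e s, 0) are nonnegative and add up to the trace of a
   commutator. *)
Let null1 s : N (e s, 0) = 0.
Proof.
have E r : N (e r, 0) = vdot (G1 *m e r) (G1 *m e r) - vdot (D1 *m e r) (D1 *m e r).
  by rewrite /N /= !mulmx0 !vdot0l !vdot0r !addr0.
have S : \sum_r N (e r, 0) = 0.
  under eq_bigr do rewrite E.
  by rewrite big_split /= sumrN trace1 subrr.
move/eqP: S; rewrite psumr_eq0 => [/allP/(_ s (mem_index_enum _))/eqP //|r _].
exact: N_ge0.
Qed.

Let null2 s : N (0, e s) = 0.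
Proof.
have E r : N (0, e r) = vdot (G2 *m e r) (G2 *m e r) - vdot (D2 *m e r) (D2 *m e r).
  by rewrite /N /= !mulmx0 !vdot0l !vdot0r !add0r.
have S : \sum_r N (0, e r) = 0.
  under eq_bigr do rewrite E.
  by rewrite big_split /= sumrN trace2 subrr.
move/eqP: S; rewrite psumr_eq0 => [/allP/(_ s (mem_index_enum _))/eqP //|r _].
exact: N_ge0.
Qed.

Let N_eq0 x : N x = 0.
Proof.
have N0 : N 0 = 0 by rewrite -(scale0r (0 : vec * vec)) null_scale// /N /= !mulmx0 !vdot0l !addr0 subr0.
have -> : x = \sum_s (x.1 s 0 *: (e s, 0)) + \sum_s (x.2 s 0 *: (0, e s)).
  rewrite [LHS]surjective_pairing.
  have cE (u : vec) : u = \sum_s u s 0 *: e s.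
    by rewrite [LHS]matrix_sum_delta; apply: eq_bigr => i _; rewrite big_ord1.
  apply/eqP; rewrite xpair_eqE /=; apply/andP.
  rewrite !raddf_sum /=; split; apply/eqP.
    rewrite [in RHS](eq_bigr (fun s => x.1 s 0 *: e s))//.
    rewrite [X in _ = _ + X]big1 ?addr0 -?cE// => i _; exact: scaler0.
  rewrite [X in _ = X + _]big1 ?add0r -?cE// => i _; exact: scaler0.
have null_sum F : (forall s, N (F s) = 0) -> N (\sum_s F s) = 0.
  by move=> NF; apply: (big_ind (fun y => N y = 0)) => // y z; exact: null_add.
by apply: null_add; apply: null_sum => s; apply: null_scale;
  [exact: null1|exact: null2].
Qed.

(** Normality of the symbols ([N_eq0]) removes the full products, so only the
    Hankel parts remain of the positivity hypothesis. *)
Lemma toeplitz_ge0_hankel_ineq : hankel_ineq L K G1 G2 D1 D2.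
Proof.
move=> p1 p2; have := N_eq0 (p1, p2); have := toeplitz_ge0 p1 p2; rewrite /N /=.
have split k u v : vdot (hi k u) (hi k v) = vdot u v - vdot (lo k u) (lo k v).
  by rewrite (vdot_lo_hi k u v) addrAC subrr add0r.
rewrite !split => Q NE; rewrite -subr_ge0; move: Q; congr (0 <= _).
rewrite loD !(vdotDl, vdotDr) -[RHS]addr0 -NE.
by do ?[move: (vdot _ _) => ?]; ring.
Qed.

End Normality.

Lemma hankel_ineqC L K G1 G2 D1 D2 :
  hankel_ineq L K G1 G2 D1 D2 -> hankel_ineq L K G2 G1 D2 D1.
Proof.
move=> H p1 p2; have := H p2 p1; rewrite [D1 *m _ + _]addrC.
congr (_ <= _).
by do ?[move: (vdot _ _) => ?]; ring.
Qed.

(** A linear change of the pair (Phi_1, Phi_2) with scalar coefficients amounts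
    to the conjugate change of the test vectors, here p2 - c^* p1 for p2.  A
    matrix c would not do, as it need not commute with the symbols. *)
Lemma hankel_ineq_sub L K G1 G2 D1 D2 (c : C) :
  hankel_ineq L K G1 G2 D1 D2 ->
  hankel_ineq L K (G1 - c%:P *: G2) G2 (D1 - c^*%:P *: D2) D2.
Proof.
move=> H p1 p2; have := H p1 (p2 - c^*%:P *: p1).
have -> : D1 *m p1 + D2 *m (p2 - c^*%:P *: p1) =
          (D1 - c^*%:P *: D2) *m p1 + D2 *m p2.
  by rewrite mulmxBr mulmxBl -scalemxAr -scalemxAl addrA addrAC.
congr (_ <= _).
rewrite !mulmxBr !mulmxBl -!scalemxAr -!scalemxAl.
move: (G1 *m p1) (G1 *m p2) (G2 *m p1) (G2 *m p2) => g11 g12 g21 g22.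
rewrite !(loD, loN, loZ).
move: (lo L g11) (lo L g12) (lo L g21) (lo L g22) => a b d e.
rewrite !(vdotDl, vdotDr, vdotNl, vdotNr, vdotZl, vdotZr) conjCK.
by do ?[move: (vdot _ _) => ?]; ring.
Qed.

End Pair.

(** * Vanishing of the co-analytic part *)

Section LowestCoefficients.
Variable C : numClosedFieldType.

Definition coefmx m k j (P : 'M[{poly C}]_(m, k)) : 'M[C]_(m, k) :=
  \matrix_(a, b) (P a b)`_j.

Lemma coefmx0_mul m k l (P : 'M[{poly C}]_(m, k)) (Q : 'M[{poly C}]_(k, l)) :
  coefmx 0 (P *m Q) = coefmx 0 P *m coefmx 0 Q.
Proof.
apply/matrixP => i j; rewrite !mxE coef_sum; apply: eq_bigr => a _.
by rewrite !mxE coef0M.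
Qed.

Lemma coefmx0_const m k (A : 'M[C]_(m, k)) : coefmx 0 (map_mx polyC A) = A.
Proof. by apply/matrixP => i j; rewrite !mxE coefC. Qed.

Lemma coefmx_mulXn m k (P : 'M[{poly C}]_(m, k)) j :
  coefmx j ('X^j *: P) = coefmx 0 P.
Proof. by apply/matrixP => a b; rewrite !mxE coefXnM ltnn subnn. Qed.

Lemma coefmx_factor m k j (P : 'M[{poly C}]_(m, k)) :
  (forall i, (i < j)%N -> coefmx i P = 0) ->
  exists2 Q, P = 'X^j *: Q & coefmx 0 Q = coefmx j P.
Proof.
move=> P0; exists (map_mx (drop_poly j) P).
  apply/matrixP => a b; rewrite !mxE -{1}(poly_take_drop j (P a b)) mulrC.
  rewrite (_ : take_poly j _ = 0) ?add0r//; apply/polyP => i.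
  rewrite coef_take_poly coef0; case: ifP => // ij.
  by have /matrixP/(_ a b) := P0 i ij; rewrite !mxE.
by apply/matrixP => a b; rewrite !mxE coef_drop_poly.
Qed.

Lemma lo_eq0_coefmx n k i (u : 'cV[{poly C}]_n) : lo k u = 0 -> (i < k)%N ->
  coefmx i u = 0.
Proof.
move=> /matrixP u0 ik; apply/matrixP => a b; have := u0 a b; rewrite !mxE.
by move=> /polyP/(_ i); rewrite coef_take_poly ik coef0.
Qed.

Variable n : nat.
Local Notation vec := 'cV[{poly C}]_n.
Local Notation mat := 'M[{poly C}]_n.

(** Cramer's rule, the determinant being invertible modulo 'X^K. *)
Lemma solve_mod_Xn (D : mat) K (v : vec) : coefmx 0 D \in unitmx ->
  exists g w : vec, D *m g = v + 'X^K *: w.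
Proof.
rewrite unitmxE unitfE => D0.
have [[a b] /= ab] : exists ab : {poly C} * {poly C}, ab.1 * \det D + ab.2 * 'X^K = 1.
  apply/Bezout_eq1_coprimepP/coprimep_expr; rewrite coprimepX.
  apply: contra D0 => /rootP D0; rewrite -D0 -/(horner_eval 0 (\det D)) -det_map_mx.
  rewrite (_ : map_mx _ _ = coefmx 0 D)//.
  by apply/matrixP => i j; rewrite !mxE -horner_coef0.
exists (a *: (\adj D *m v)), (- b *: v).
have E : a * \det D = 1 + 'X^K * - b by rewrite -ab; ring.
by rewrite -scalemxAr mulmxA mul_mx_adj mul_scalar_mx !scalerA E scalerDl scale1r.
Qed.

(** Otherwise let k be the least index of a nonzero coefficient of G1; then
    0 < k < L = l + 1.  Test vectors divisible by 'X^l have G1 p_i divisible by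
    'X^L, so if the right side vanishes, so does G2 p2 modulo 'X^L: the
    lowest coefficient of p2 / 'X^l must be zero ([p2_lowest]).  This refutes
    D1(0) invertible, as p2 can then be prescribed.  If D2(0) is invertible,
    p1 can be prescribed and the p2 solving the equation has an extra factor 'X;
    so with p1 = 'X^(l - k) x the only term with G1 left is the square of G1 p1,
    whose coefficient of index l is the k-th coefficient of G1 applied to x. *)
Lemma hankel_ineq_coef_eq0 L K (G1 G2 D1 D2 : mat) :
  hankel_ineq L K G1 G2 D1 D2 ->
  coefmx 0 G1 = 0 -> coefmx 0 G2 \in unitmx ->
  coefmx 0 D1 \in unitmx \/ coefmx 0 D2 \in unitmx ->
  forall k, (k < L)%N -> coefmx k G1 = 0.
Proof.
move=> ineq G1_0 G2_0 D_0 k kL; apply/eqP; apply/negPn/negP => Gk.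
have [{kL Gk} {}k /andP[kL Gk] kmin] :
  {k | (k < L)%N && (coefmx k G1 != 0) & forall j, (j < L)%N && (coefmx j G1 != 0) -> (k <= j)%N}.
  have ex : exists k, (k < L)%N && (coefmx k G1 != 0) by exists k; rewrite kL.
  by exists (ex_minn ex); case: ex_minnP.
have [H G1E H0] : exists2 H, G1 = 'X^k *: H & coefmx 0 H = coefmx k G1.
  apply: coefmx_factor => i ik; apply/eqP/negPn/negP => Gi.
  by have := kmin i; rewrite Gi (ltn_trans ik kL) leqNgt ik => /(_ isT).
have k_gt0 : (0 < k)%N by case: (k) Gk => //; rewrite G1_0 eqxx.
rewrite -H0 in Gk.
have [x Hx] : exists x : 'cV[C]_n, coefmx 0 H *m x != 0.
  have [j] : exists j, col j (coefmx 0 H) != 0.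
    apply/existsP; rewrite -negb_forall; apply: contra Gk => /forallP c0.
    by apply/eqP/matrixP => a b; have /eqP/matrixP/(_ a 0) := c0 b; rewrite !mxE.
  by rewrite colE; exists (delta_mx j 0).
have x0 : x != 0 by apply: contra Hx => /eqP ->; rewrite mulmx0.
case: L kL ineq {kmin} => // l kl ineq.
have loX (j : nat) (w : vec) : (l < j)%N -> lo l.+1 ('X^j *: w) = 0.
  exact: lo_mulXn.
have G2_vanish (u : vec) :
    vdot (lo l.+1 ('X^l *: u)) (lo l.+1 ('X^l *: u)) <= 0 -> coefmx 0 u = 0.
  move=> le0; rewrite -(coefmx_mulXn u l); apply: (lo_eq0_coefmx _ (ltnSn l)).
  by apply: vdot_eq0; apply/le_anti; rewrite le0 vdot_ge0.
have p2_lowest (g1 g2 w : vec) : D1 *m g1 + D2 *m g2 = 'X^K *: w -> coefmx 0 g2 = 0.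
  move=> Dg; have := ineq ('X^l *: g1) ('X^l *: g2).
  rewrite G1E -!scalemxAl -!scalemxAr -scalerDr Dg !scalerA -!exprD.
  have kl1 : (l < k + l)%N by rewrite -[X in (X < _)%N]add0n ltn_add2r.
  rewrite !(loX (k + l)%N)// !(vdot0l, vdot0r, add0r).
  rewrite lo_mulXn ?leq_addl// vdot0l => /G2_vanish.
  rewrite coefmx0_mul => /(congr1 (mulmx (invmx (coefmx 0 G2)))).
  by rewrite mulKmx// mulmx0.
case: D_0 => [D1_0|D2_0].
  have [g [w Dg]] := solve_mod_Xn K (- (D2 *m map_mx polyC x)) D1_0.
  have := p2_lowest g (map_mx polyC x) w; rewrite Dg addrAC addNr add0r => /(_ erefl).
  by rewrite coefmx0_const => /eqP; rewrite (negPf x0).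
have [g [w Dg]] := solve_mod_Xn K (- (D1 *m map_mx polyC x)) D2_0.
have {}Dg : D1 *m map_mx polyC x + D2 *m g = 'X^K *: w by rewrite Dg addrA subrr add0r.
have g0 := p2_lowest _ _ _ Dg.
have [r gE _] : exists2 r, g = 'X^1 *: r & coefmx 0 r = coefmx 1 g.
  by apply: coefmx_factor; case.
have lk : (l - k + k = l)%N by rewrite subnK.
have G1x : G1 *m ('X^(l - k) *: map_mx polyC x) = 'X^l *: (H *m map_mx polyC x).
  by rewrite G1E -scalemxAl -scalemxAr scalerA -exprD addnC lk.
have G1g : G1 *m ('X^(l - k) *: g) = 'X^(l.+1) *: (H *m r).
  by rewrite G1E gE -scalemxAl -!scalemxAr !scalerA -!exprD addn1 (addnC k) addSn lk.
have := ineq ('X^(l - k) *: map_mx polyC x) ('X^(l - k) *: g).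
rewrite G1x G1g (loX l.+1)// !(vdot0l, vdot0r, addr0) -!scalemxAr -scalerDr Dg.
rewrite scalerA -exprD (lo_mulXn _ (leq_addl _ _)) vdot0l => le0.
have Hx0 : vdot (lo l.+1 ('X^l *: (H *m map_mx polyC x)))
                (lo l.+1 ('X^l *: (H *m map_mx polyC x))) = 0.
  by apply/le_anti; rewrite vdot_ge0 andbT (le_trans _ le0)// lerDl vdot_ge0.
have := lo_eq0_coefmx (vdot_eq0 Hx0) (ltnSn l).
rewrite coefmx_mulXn coefmx0_mul coefmx0_const => /eqP.
by rewrite (negPf Hx).
Qed.

End LowestCoefficients.

(** * Integration over the unit circle *)

Local Open Scope classical_set_scope.
Local Open Scope ring_scope.

Section CircleIntegral.
Variable R : realType.
Local Notation C := R[i].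
Local Notation mu := (@lebesgue_measure R).
Local Notation angles := (@angles R).
Implicit Types (f g h u v : C -> C) (c z : C).

Let measurable_angles : measurable (angles : set (measurableTypeR R)).
Proof. exact: measurable_itv. Qed.

Definition circle_integrable f : Prop :=
  mu.-integrable angles (EFin \o (fun t => complex.Re (f (circle t)))) /\
  mu.-integrable angles (EFin \o (fun t => complex.Im (f (circle t)))).

(** Integrals, L^2 and H^2 see a function on the complex plane only through its
    restriction to the unit circle. *)
Definition eq_circle f g := forall t : R, f (circle t) = g (circle t).

Lemma circle_integral_eq f g : eq_circle f g ->
  circle_integral f = circle_integral g.
Proof.
move=> fg; rewrite /circle_integral; congr (_ * (_ +i* _));
  by apply: eq_Rintegral => t _ /=; rewrite fg.
Qed.

Lemma circle_integrable_eq f g : eq_circle f g ->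
  circle_integrable f -> circle_integrable g.
Proof.
move=> fg [fr fi]; split; [move: fr|move: fi]; apply: eq_integrable => //;
  by move=> t _ /=; rewrite fg.
Qed.

Lemma ReD (x y : C) : complex.Re (x + y) = complex.Re x + complex.Re y.
Proof. by case: x; case: y. Qed.
Lemma ImD (x y : C) : complex.Im (x + y) = complex.Im x + complex.Im y.
Proof. by case: x; case: y. Qed.
Lemma ReM (x y : C) : complex.Re (x * y) =
  complex.Re x * complex.Re y - complex.Im x * complex.Im y.
Proof. by case: x; case: y. Qed.
Lemma ImM (x y : C) : complex.Im (x * y) =
  complex.Re x * complex.Im y + complex.Im x * complex.Re y.
Proof. by case: x; case: y. Qed.
Lemma ReJ (x : C) : complex.Re x^* = complex.Re x.
Proof. by case: x. Qed.
Lemma ImJ (x : C) : complex.Im x^* = - complex.Im x.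
Proof. by case: x. Qed.

Lemma circle_integrableD f g : circle_integrable f -> circle_integrable g ->
  circle_integrable (fun z => f z + g z).
Proof.
move=> [fr fi] [gr gi]; split.
- have := integrableD measurable_angles fr gr.
  by apply: eq_integrable => // t _ /=; rewrite ReD EFinD.
- have := integrableD measurable_angles fi gi.
  by apply: eq_integrable => // t _ /=; rewrite ImD EFinD.
Qed.

Lemma circle_integralD f g : circle_integrable f -> circle_integrable g ->
  circle_integral (fun z => f z + g z) = circle_integral f + circle_integral g.
Proof.
move=> [fr fi] [gr gi]; rewrite /circle_integral -mulrDr; congr (_ * _).
apply/eqP; rewrite eq_complex /=; apply/andP; split; apply/eqP.
- by under eq_Rintegral do rewrite ReD; rewrite RintegralD.
- by under eq_Rintegral do rewrite ImD; rewrite RintegralD.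
Qed.

Lemma circle_integralZ c f : circle_integrable f ->
  circle_integral (fun z => c * f z) = c * circle_integral f.
Proof.
have iZ (a : R) (F : R -> R) : mu.-integrable angles (EFin \o F) ->
    mu.-integrable angles (EFin \o (fun t => a * F t)).
  by move=> iF; have := integrableZl measurable_angles a iF; apply: eq_integrable.
move=> [fr fi]; rewrite /circle_integral mulrCA; congr (_ * _).
apply/eqP; rewrite eq_complex ReM ImM [X in X && _]/= [X in _ && X]/=; apply/andP; split; apply/eqP.
- under eq_Rintegral do rewrite ReM.
  by rewrite RintegralB ?RintegralZl//; exact: iZ.
- under eq_Rintegral do rewrite ImM.
  by rewrite RintegralD ?RintegralZl//; exact: iZ.
Qed.

Lemma circle_integral_conj f : circle_integrable f ->
  circle_integral (fun z => (f z)^*) = (circle_integral f)^*.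
Proof.
move=> [fr fi]; rewrite /circle_integral -[RHS]/(conjc _) rmorphM /= oppr0; congr (_ * _).
congr (_ +i* _); first by apply: eq_Rintegral => t _; rewrite ReJ.
by under eq_Rintegral do rewrite ImJ -mulN1r; rewrite RintegralZl// mulN1r.
Qed.

(** * Square-integrable functions on the circle *)

Lemma circleJ (t : R) : circle t * (circle t)^* = 1.
Proof.
apply/eqP; rewrite eq_complex /=; apply/andP; split; apply/eqP; last by ring.
by rewrite -(cos2Dsin2 t); ring.
Qed.

Lemma circle_neq0 (t : R) : circle t != 0.
Proof.
by apply/negP=> /eqP c0; have := circleJ t; rewrite c0 mul0r => /eqP;
  rewrite eq_sym oner_eq0.
Qed.

Lemma circleV (t : R) : (circle t)^-1 = (circle t)^*.
Proof.
by apply: (mulfI (circle_neq0 t)); rewrite circleJ mulfV ?circle_neq0.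
Qed.

Lemma measurable_circle_Re : measurable_fun angles (fun t : R => complex.Re (circle t)).
Proof.
apply: measurable_funS (measurableT) _ _ => //=.
by apply: continuous_measurable_fun; exact: continuous_cos.
Qed.

Lemma measurable_circle_Im : measurable_fun angles (fun t : R => complex.Im (circle t)).
Proof.
apply: measurable_funS (measurableT) _ _ => //=.
by apply: continuous_measurable_fun; exact: continuous_sin.
Qed.

Let sqmod c : R := complex.Re c ^+ 2 + complex.Im c ^+ 2.

Lemma L2_eq f g : eq_circle f g -> L2 f -> L2 g.
Proof.
move=> fg [mr mi i]; split.
- by under eq_fun do rewrite -fg.
- by under eq_fun do rewrite -fg.
- by under eq_fun do rewrite -fg.
Qed.

Lemma L2_dominated (k : R) f u v :
  measurable_fun angles (fun t => complex.Re (f (circle t))) ->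
  measurable_fun angles (fun t => complex.Im (f (circle t))) ->
  L2 u -> L2 v ->
  (forall t, sqmod (f (circle t)) <=
     k * (sqmod (u (circle t)) + sqmod (v (circle t)))) ->
  L2 f.
Proof.
move=> mr mi [_ _ iu] [_ _ iv] le; split => //.
have iuv := integrableZl measurable_angles k (integrableD measurable_angles iu iv).
apply: le_integrable iuv => //.
- apply/measurable_EFinP; apply: measurable_funD; exact: measurable_funX.
- move=> t _ /=; rewrite lee_fin ger0_norm ?addr_ge0 ?sqr_ge0//.
  by apply: le_trans (ler_norm _); exact: le t.
Qed.

Lemma L2D f g : L2 f -> L2 g -> L2 (fun z => f z + g z).
Proof.
move=> Lf Lg; have [fr fi _] := Lf; have [gr gi _] := Lg.
apply: (@L2_dominated 2 _ f g) => //.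
- by under eq_fun do rewrite ReD; exact: measurable_funD.
- by under eq_fun do rewrite ImD; exact: measurable_funD.
- move=> t; rewrite /sqmod ReD ImD.
  move: (complex.Re _) (complex.Re _) (complex.Im _) (complex.Im _) => a b c d.
  have := sqr_ge0 (a - b); have := sqr_ge0 (c - d); rewrite !expr2; lra.
Qed.

Lemma L2_mul_bounded (k : R) u f :
  measurable_fun angles (fun t => complex.Re (u (circle t))) ->
  measurable_fun angles (fun t => complex.Im (u (circle t))) ->
  (forall t, sqmod (u (circle t)) <= k) ->
  L2 f -> L2 (fun z => u z * f z).
Proof.
move=> ur ui uk Lf; have [fr fi _] := Lf.
apply: (@L2_dominated k _ f f) => //.
- under eq_fun do rewrite ReM.
  by apply: measurable_funB; exact: measurable_funM.
- under eq_fun do rewrite ImM.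
  by apply: measurable_funD; exact: measurable_funM.
- move=> t; have := uk t; rewrite /sqmod ReM ImM.
  move: (complex.Re (f _)) (complex.Re _) (complex.Im (f _)) (complex.Im _)
    => a b c d le.
  have ge0 : 0 <= a ^+ 2 + c ^+ 2 by rewrite addr_ge0 ?sqr_ge0.
  have ge1 : 0 <= k by apply: le_trans le; rewrite addr_ge0 ?sqr_ge0.
  have := ler_wpM2r ge0 le; have := mulr_ge0 ge1 ge0; rewrite !expr2; lra.
Qed.

Lemma L2Z c f : L2 f -> L2 (fun z => c * f z).
Proof.
by apply: (@L2_mul_bounded (sqmod c) (fun=> c)) => //; exact: measurable_cst.
Qed.

Lemma L2_mulz f : L2 f -> L2 (fun z => z * f z).
Proof.
apply: (@L2_mul_bounded 1 id); first exact: measurable_circle_Re.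
  exact: measurable_circle_Im.
by move=> t; rewrite /sqmod /= cos2Dsin2.
Qed.

Lemma L2_mulVz f : L2 f -> L2 (fun z => z^-1 * f z).
Proof.
apply: (@L2_mul_bounded 1 (fun z => z^-1)).
- by under eq_fun do rewrite circleV ReJ; exact: measurable_circle_Re.
- under eq_fun do rewrite circleV ImJ.
  by apply: measurableT_comp => //; exact: measurable_circle_Im.
- by move=> t; rewrite circleV /sqmod /= sqrrN cos2Dsin2.
Qed.

Lemma L2_cst c : L2 (fun=> c).
Proof.
split; [exact: measurable_cst|exact: measurable_cst|].
have fin_angles : (mu angles < +oo)%E.
  rewrite /Defs.angles lebesgue_measure_itv /=.
  by case: ifP => _; rewrite -?EFinB ltry.
apply: measurable_bounded_integrable => //.
exact: bounded_cst.
Qed.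

Lemma L2_mul_conj_integrable f g : L2 f -> L2 g ->
  circle_integrable (fun z => f z * (g z)^*).
Proof.
move=> [fr fi i1] [gr gi i2].
have iuv := integrableD measurable_angles i1 i2.
split; apply: le_integrable iuv => //.
- apply/measurable_EFinP; under eq_fun do rewrite ReM ReJ ImJ.
  apply: measurable_funB; apply: measurable_funM => //.
  exact: measurableT_comp.
- move=> t _ /=; rewrite lee_fin ReM ReJ ImJ.
  apply: le_trans (ler_norm _); rewrite ler_norml.
  move: (complex.Re _) (complex.Re _) (complex.Im _) (complex.Im _) => a b c d.
  have := sqr_ge0 (a - b); have := sqr_ge0 (c - d).
  have := sqr_ge0 (a + b); have := sqr_ge0 (c + d).
  have := sqr_ge0 a; have := sqr_ge0 b; have := sqr_ge0 c; have := sqr_ge0 d.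
  rewrite !expr2; lra.
- apply/measurable_EFinP; under eq_fun do rewrite ImM ReJ ImJ.
  apply: measurable_funD; apply: measurable_funM => //.
  exact: measurableT_comp.
- move=> t _ /=; rewrite lee_fin ImM ReJ ImJ.
  apply: le_trans (ler_norm _); rewrite ler_norml.
  move: (complex.Re _) (complex.Re _) (complex.Im _) (complex.Im _) => a b c d.
  have := sqr_ge0 (a - d); have := sqr_ge0 (c - b).
  have := sqr_ge0 (a + d); have := sqr_ge0 (c + b).
  have := sqr_ge0 a; have := sqr_ge0 b; have := sqr_ge0 c; have := sqr_ge0 d.
  rewrite !expr2; lra.
Qed.

Lemma circleX (t : R) n : circle t ^+ n = circle (n%:R * t).
Proof.
elim: n => [|n IH]; first by rewrite expr0 mul0r /circle cos0 sin0.
rewrite exprS IH -natr1 mulrDl mul1r addrC /circle cosD sinD.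
by apply/eqP; rewrite eq_complex /=; apply/andP; split; apply/eqP; ring.
Qed.

Lemma Rintegral_derive_angles (f F : R -> R) :
  (forall x : R, is_derive x (1 : R) F (f x)) -> continuous f ->
  \int[mu]_(t in angles) f t = F (pi *+ 2) - F 0.
Proof.
move=> dF cf; have cF : continuous F.
  move=> x; apply/differentiable_continuous/derivable1_diffP.
  by have [] := dF x.
rewrite /Rintegral (@continuous_FTC2 _ f F) //.
- by rewrite pmulrn_lgt0 ?pi_gt0.
- exact: continuous_subspaceT.
- split.
  + by move=> x _; have [] := dF x.
  + by apply: cvg_at_right_filter; exact: cF.
  + by apply: cvg_at_left_filter; exact: cF.
- by move=> x _; rewrite derive1E; have [] := dF x.
Qed.

Lemma circle_integral_primitive f (F G : R -> R) :
  (forall t : R, is_derive t (1 : R) F (complex.Re (f (circle t)))) ->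
  (forall t : R, is_derive t (1 : R) G (complex.Im (f (circle t)))) ->
  continuous (fun t => complex.Re (f (circle t))) ->
  continuous (fun t => complex.Im (f (circle t))) ->
  circle_integral f = ((pi *+ 2)^-1)%:C *
    ((F (pi *+ 2) - F 0) +i* (G (pi *+ 2) - G 0)).
Proof.
move=> dF dG cF cG; rewrite /circle_integral.
by rewrite (Rintegral_derive_angles dF cF) (Rintegral_derive_angles dG cG).
Qed.

(** Orthonormality of the powers of z. *)
Lemma circle_integral_pow n :
  circle_integral (fun z : C => z ^+ n) = (n == 0)%:R.
Proof.
case: n => [|n].
  rewrite (@circle_integral_primitive _ id (fun=> 0)); last 2 first.
  - by move=> t; exact: cst_continuous.
  - by move=> t; exact: cst_continuous.
  have pi2 : (pi *+ 2 : R) != 0 by rewrite mulrn_eq0 /= gt_eqF ?pi_gt0.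
  by apply/eqP; rewrite eq_complex /= !subr0 !mul0r mulr0 subr0 addr0 mulVf ?eqxx.
have n0 : (n.+1%:R : R) != 0 by rewrite pnatr_eq0.
have co (F : R -> R) : continuous F -> continuous (fun t : R => F (n.+1%:R * t)).
  move=> cF x; apply: (@continuous_comp _ _ _ (fun t : R => n.+1%:R * t) F).
    by apply: continuousM; [exact: cst_continuous|exact: cvg_id].
  exact: cF.
have per : n.+1%:R * (pi *+ 2) = 0 + (pi *+ 2) *+ n.+1 :> R.
  by rewrite add0r mulr_natl.
have s2 : sin (n.+1%:R * (pi *+ 2)) = 0 :> R.
  by rewrite per (periodicn (@sinD2pi R)) sin0.
have c2 : cos (n.+1%:R * (pi *+ 2)) = 1 :> R.
  by rewrite per (periodicn (@cosD2pi R)) cos0.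
have dF (t : R) : is_derive t (1 : R) (fun t => n.+1%:R^-1 * sin (n.+1%:R * t))
    (complex.Re (circle t ^+ n.+1)).
  rewrite circleX; apply: is_derive_eq.
  by rewrite /GRing.scale /= mulr1 mulrCA mulVf ?mulr1.
have dG (t : R) : is_derive t (1 : R) (fun t => - n.+1%:R^-1 * cos (n.+1%:R * t))
    (complex.Im (circle t ^+ n.+1)).
  rewrite circleX; apply: is_derive_eq.
  by rewrite /GRing.scale /= mulr1 mulNr mulNr mulrN opprK mulrCA mulVf ?mulr1.
rewrite (circle_integral_primitive dF dG).
- by rewrite s2 c2 !mulr0 sin0 cos0 !mulr1 mulr0 !subrr mulr0.
- by under eq_fun do rewrite circleX; exact: (co _ (@continuous_cos R)).
- by under eq_fun do rewrite circleX; exact: (co _ (@continuous_sin R)).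
Qed.

End CircleIntegral.

(** * The Hardy space *)

Section Hardy.
Variable R : realType.
Local Notation C := R[i].
Implicit Types (f g h u v : C -> C) (c z : C).

Definition dotc f g : C := circle_integral (fun z => f z * (g z)^*).

Lemma dotc_eq f f' g g' : eq_circle f f' -> eq_circle g g' ->
  dotc f g = dotc f' g'.
Proof. by move=> ff gg; apply: circle_integral_eq => t; rewrite ff gg. Qed.

Lemma dotcDl f g h : L2 f -> L2 g -> L2 h ->
  dotc (fun z => f z + g z) h = dotc f h + dotc g h.
Proof.
move=> Lf Lg Lh; rewrite /dotc -circle_integralD; last 2 first.
- exact: L2_mul_conj_integrable.
- exact: L2_mul_conj_integrable.
by apply: circle_integral_eq => t; rewrite mulrDl.
Qed.

Lemma dotcZl c f h : L2 f -> L2 h ->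
  dotc (fun z => c * f z) h = c * dotc f h.
Proof.
move=> Lf Lh; rewrite /dotc -circle_integralZ; last first.
  exact: L2_mul_conj_integrable.
by apply: circle_integral_eq => t; rewrite mulrA.
Qed.

Lemma dotc_conj f g : L2 f -> L2 g -> (dotc f g)^* = dotc g f.
Proof.
move=> Lf Lg; rewrite /dotc -circle_integral_conj; last first.
  exact: L2_mul_conj_integrable.
by apply: circle_integral_eq => t; rewrite rmorphM /= conjCK mulrC.
Qed.

Lemma L2_0 : L2 (fun=> 0 : C).
Proof. exact: L2_cst. Qed.

Lemma dotc0l h : dotc (fun=> 0) h = 0.
Proof.
rewrite (_ : (fun=> 0) = (fun z : C => 0 * 0)); last by rewrite mul0r.
rewrite -[RHS](mul0r (circle_integral (fun=> 0 : C))).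
rewrite -circle_integralZ; first by apply: circle_integral_eq => t; rewrite !mul0r.
have := L2_mul_conj_integrable L2_0 L2_0; apply: circle_integrable_eq.
by move=> t; rewrite mul0r.
Qed.

Lemma dotcBl f g h : L2 f -> L2 g -> L2 h ->
  dotc (fun z => f z - g z) h = dotc f h - dotc g h.
Proof.
move=> Lf Lg Lh; rewrite -mulN1r -dotcZl// -dotcDl//; last exact: L2Z.
by apply: dotc_eq => // t; rewrite mulN1r.
Qed.

Lemma L2B f g : L2 f -> L2 g -> L2 (fun z => f z - g z).
Proof.
move=> Lf Lg; have := L2D Lf (L2Z (-1) Lg); apply: L2_eq => t.
by rewrite mulN1r.
Qed.

Lemma L2_sum (I : Type) (r : seq I) (F : I -> C -> C) :
  (forall i, L2 (F i)) -> L2 (fun z => \sum_(i <- r) F i z).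
Proof.
move=> LF; elim: r => [|i r IH].
  by apply: L2_eq L2_0 => t; rewrite big_nil.
by apply: L2_eq (L2D (LF i) IH) => t; rewrite big_cons.
Qed.

Lemma dotc_suml (I : Type) (r : seq I) (F : I -> C -> C) h :
  (forall i, L2 (F i)) -> L2 h ->
  dotc (fun z => \sum_(i <- r) F i z) h = \sum_(i <- r) dotc (F i) h.
Proof.
move=> LF Lh; elim: r => [|i r IH].
  by rewrite big_nil -[RHS](dotc0l h); apply: dotc_eq => // t; rewrite big_nil.
rewrite big_cons -IH -dotcDl//; last exact: L2_sum.
by apply: dotc_eq => // t; rewrite big_cons.
Qed.

Lemma dotc_mulVz f g : dotc (fun z => z^-1 * f z) g = dotc f (fun z => z * g z).
Proof.
by apply: circle_integral_eq => t; rewrite circleV rmorphM /= -mulrA mulrCA.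
Qed.

Lemma circle_exprzV (t : R) (k : int) : circle t ^ (- k) = (circle t ^ k)^*.
Proof.
have J n : (circle t ^+ n)^* = (circle t ^+ n)^-1.
  by rewrite rmorphXn -exprVn circleV.
case: k => n; first by rewrite -exprnN -exprnP J.
by rewrite NegzE opprK -exprnN -exprnP -J conjCK.
Qed.

Lemma fourierE f k : fourier f k = dotc f (fun z => z ^ k).
Proof. by apply: circle_integral_eq => t; rewrite circle_exprzV. Qed.

Lemma L2_exp n : L2 (fun z : C => z ^+ n).
Proof.
elim: n => [|n IH]; first by apply: L2_eq (L2_cst 1) => t; rewrite expr0.
by apply: L2_eq (L2_mulz IH) => t; rewrite exprS.
Qed.

Lemma L2_exprz (k : int) : L2 (fun z : C => z ^ k).
Proof.
case: k => n; first exact: L2_exp.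
elim: n => [|n IH]; first by apply: L2_eq (L2_mulVz (L2_cst 1)) => t; rewrite mulr1.
apply: (L2_eq _ (L2_mulVz IH)); rewrite /eq_circle => t.
by rewrite !NegzE -!exprnN (exprSr _ n.+1) invfM mulrC.
Qed.

Lemma fourier_eq f g k : eq_circle f g -> fourier f k = fourier g k.
Proof. by move=> fg; rewrite !fourierE; apply: dotc_eq. Qed.

Lemma fourierD f g k : L2 f -> L2 g ->
  fourier (fun z => f z + g z) k = fourier f k + fourier g k.
Proof. by move=> ? ?; rewrite !fourierE dotcDl//; exact: L2_exprz. Qed.

Lemma fourierB f g k : L2 f -> L2 g ->
  fourier (fun z => f z - g z) k = fourier f k - fourier g k.
Proof. by move=> ? ?; rewrite !fourierE dotcBl//; exact: L2_exprz. Qed.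

Lemma fourierZ c f k : L2 f -> fourier (fun z => c * f z) k = c * fourier f k.
Proof. by move=> ?; rewrite !fourierE dotcZl//; exact: L2_exprz. Qed.

Lemma fourier_mulz f k : fourier (fun z => z * f z) k = fourier f (k - 1).
Proof.
apply: circle_integral_eq => t.
by rewrite opprB expfzDr ?circle_neq0// expr1z [RHS]mulrCA mulrA.
Qed.

Lemma fourier_mulVz f k : fourier (fun z => z^-1 * f z) k = fourier f (k + 1).
Proof.
rewrite -(addrK 1 k) -fourier_mulz addrK.
by apply: fourier_eq => t; rewrite mulrA divff ?circle_neq0 ?mul1r.
Qed.

Lemma fourier_exp n (k : int) : fourier (fun z : C => z ^+ n) k = (n%:Z == k)%:R.
Proof.
have pos (m : nat) : circle_integral (fun z : C => z ^ m%:Z) = (m == 0)%:R.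
  exact: circle_integral_pow.
have E : fourier (fun z : C => z ^+ n) k = circle_integral (fun z : C => z ^ (n%:Z - k)).
  by apply: circle_integral_eq => t; rewrite exprnP -expfzDr ?circle_neq0.
rewrite E -subr_eq0; case: (n%:Z - k) => m; first exact: pos.
rewrite NegzE.
have -> : circle_integral (fun z : C => z ^ (- m.+1%:Z)) =
          circle_integral (fun z : C => (z ^ m.+1%:Z)^*).
  by apply: circle_integral_eq => t; rewrite circle_exprzV.
rewrite circle_integral_conj; first by rewrite pos rmorph0.
apply: circle_integrable_eq (L2_mul_conj_integrable (L2_exp m.+1) (L2_cst 1)).
by move=> t; rewrite rmorph1 mulr1.
Qed.

Lemma H2_L2 f : H2 f -> L2 f. Proof. by case. Qed.

Lemma H2_eq f g : eq_circle f g -> H2 f -> H2 g.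
Proof.
by move=> fg [Lf f0]; split; [exact: L2_eq Lf|move=> k /f0 <-; apply/esym/fourier_eq].
Qed.

Lemma H2D f g : H2 f -> H2 g -> H2 (fun z => f z + g z).
Proof.
move=> [Lf f0] [Lg g0]; split; first exact: L2D.
by move=> k k0; rewrite fourierD// f0// g0// addr0.
Qed.

Lemma H2Z c f : H2 f -> H2 (fun z => c * f z).
Proof.
by move=> [Lf f0]; split; [exact: L2Z|move=> k k0; rewrite fourierZ// f0// mulr0].
Qed.

Lemma H2B f g : H2 f -> H2 g -> H2 (fun z => f z - g z).
Proof.
by move=> Hf Hg; apply: H2_eq (H2D Hf (H2Z (-1) Hg)) => t; rewrite mulN1r.
Qed.

Lemma H2_mulz f : H2 f -> H2 (fun z => z * f z).
Proof.
move=> [Lf f0]; split; first exact: L2_mulz.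
move=> k k0; rewrite fourier_mulz f0//.
by apply: le_lt_trans k0; rewrite gerDl.
Qed.

Lemma H2_1 : H2 (fun=> 1 : C).
Proof.
split=> [|k k0]; first exact: L2_cst.
by rewrite -(fourier_eq (f := fun z => z ^+ 0))// fourier_exp gt_eqF.
Qed.

Lemma H2_0 : H2 (fun=> 0 : C).
Proof. by apply: H2_eq (H2Z 0 H2_1) => t; rewrite mul0r. Qed.

Lemma H2_sum (I : Type) (r : seq I) (F : I -> C -> C) :
  (forall i, H2 (F i)) -> H2 (fun z => \sum_(i <- r) F i z).
Proof.
move=> LF; elim: r => [|i r IH].
  by apply: H2_eq H2_0 => t; rewrite big_nil.
by apply: H2_eq (H2D (LF i) IH) => t; rewrite big_cons.
Qed.

Lemma H2_poly_mul (p : {poly C}) f : H2 f -> H2 (fun z => p.[z] * f z).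
Proof.
move=> Hf; elim/poly_ind: p => [|p c IH].
  by apply: H2_eq H2_0 => t; rewrite horner0 mul0r.
apply: H2_eq (H2D (H2_mulz IH) (H2Z c Hf)) => t.
by rewrite hornerMXaddC mulrDl mulrA (mulrC p.[_]).
Qed.

Lemma H2_poly (p : {poly C}) : H2 (fun z => p.[z]).
Proof. by apply: H2_eq (H2_poly_mul p H2_1) => t; rewrite mulr1. Qed.

Lemma L2_poly (p : {poly C}) : L2 (fun z => p.[z]).
Proof. exact/H2_L2/H2_poly. Qed.

Lemma fourier_poly (p : {poly C}) (k : nat) : fourier (fun z => p.[z]) k = p`_k.
Proof.
rewrite (@fourier_eq _ (fun z => \sum_(i < size p) p`_i * z ^+ i)); last first.
  by move=> t; rewrite horner_coef.
rewrite fourierE dotc_suml; last 2 first.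
- by move=> i; apply: L2Z; exact: L2_exp.
- exact: L2_exp.
transitivity (\sum_(i < size p) p`_i * ((i : nat) == k)%:R).
  apply: eq_bigr => i _; rewrite -fourierE fourierZ; last exact: L2_exp.
  by rewrite fourier_exp.
case: (ltnP k (size p)) => kp.
  rewrite (bigD1 (Ordinal kp)) //= eqxx mulr1 big1 ?addr0// => i /negbTE ik.
  by rewrite -val_eqE /= in ik; rewrite ik mulr0.
rewrite big1 => [|i _]; first by rewrite nth_default.
by rewrite (_ : (_ == _) = false) ?mulr0//; apply/ltn_eqF/(leq_trans _ kp).
Qed.

End Hardy.

(** * The projection onto the Hardy space *)

Section Projection.
Variable R : realType.
Local Notation C := R[i].
Implicit Types (f g h u v : C -> C) (c z : C).

(** g represents the orthogonal projection of u onto H^2; it is determined up to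
    a null set only, hence a relation. *)
Definition is_proj u g := H2 g /\
  forall h, H2 h -> dotc (fun z => u z - g z) h = 0.

Lemma is_proj_eq u u' g g' : eq_circle u u' -> eq_circle g g' ->
  is_proj u g -> is_proj u' g'.
Proof.
move=> uu gg [Hg ug]; split; first exact: H2_eq Hg.
move=> h Hh; rewrite -(ug _ Hh); apply: dotc_eq => // t.
by rewrite uu gg.
Qed.

Lemma is_proj_H2 u : H2 u -> is_proj u u.
Proof.
move=> Hu; split=> // h Hh; rewrite -[RHS](dotc0l h).
by apply: dotc_eq => // t; rewrite subrr.
Qed.

Lemma is_proj_dotc u g h : L2 u -> is_proj u g -> H2 h -> dotc g h = dotc u h.
Proof.
move=> Lu [Hg ug] Hh; apply/esym/eqP; rewrite -subr_eq0 -dotcBl ?ug//; exact: H2_L2.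
Qed.

Lemma is_proj_dotc_unique u v g g' k k' : L2 u -> L2 v ->
  is_proj u g -> is_proj u g' -> is_proj v k -> is_proj v k' ->
  dotc g k = dotc g' k'.
Proof.
move=> Lu Lv ug ug' vk vk'.
have [Hg' _] := ug'; have [Hk _] := vk; have [Hk' _] := vk'.
rewrite (is_proj_dotc Lu ug Hk) -(is_proj_dotc Lu ug' Hk).
have [Lg' Lk Lk'] := And3 (H2_L2 Hg') (H2_L2 Hk) (H2_L2 Hk').
rewrite -(dotc_conj Lk Lg') -(dotc_conj Lk' Lg').
by rewrite (is_proj_dotc Lv vk Hg') -(is_proj_dotc Lv vk' Hg').
Qed.

(** The backward shift of the projection: z^-1 times the constant g(0) is
    orthogonal to H^2, and so is z^-1 (u - g), since multiplication by z is
    unitary and maps H^2 into itself. *)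
Lemma is_proj_mulVz u g : L2 u -> is_proj u g ->
  is_proj (fun z => z^-1 * u z) (fun z => z^-1 * (g z - fourier g 0)).
Proof.
move=> Lu [Hg ug]; set c := fourier g 0.
have Lg := H2_L2 Hg.
have Hc : H2 (fun=> c) by apply: H2_eq (H2Z c (H2_1 R)) => t; rewrite mulr1.
have Hgc := H2B Hg Hc.
split; first split.
- exact/L2_mulVz/H2_L2.
- move=> k k0; rewrite fourier_mulVz.
  have [k1|k1] := ltP (k + 1) 0; first by case: Hgc => _ ->.
  have -> : k + 1 = 0 by apply/le_anti; rewrite k1 andbT lezD1.
  rewrite fourierB//; last exact: L2_cst.
  rewrite -/c (@fourier_eq _ (fun=> c) (fun z => c%:P.[z])) ?fourier_poly.
    by rewrite coefC eqxx subrr.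
  by move=> t; rewrite hornerC.
- move=> h Hh; have Lh := H2_L2 Hh.
  transitivity (dotc (fun z => z^-1 * ((u z - g z) + c)) h).
    by apply: dotc_eq => // t; rewrite -mulrBr opprB addrA addrAC.
  rewrite dotc_mulVz dotcDl; [|exact: L2B|exact: L2_cst|exact: L2_mulz].
  rewrite ug ?add0r; last exact: H2_mulz.
  transitivity (c * (fourier h (-1))^*); last by case: Hh => _ ->; rewrite ?rmorph0 ?mulr0.
  rewrite fourierE dotc_conj//; last exact: L2_exprz.
  rewrite -dotcZl//; last exact: L2_exprz.
  rewrite -dotc_mulVz; apply: dotc_eq => // t.
  by rewrite mulrC exprN1.
Qed.

Lemma L2_expVz L u : L2 u -> L2 (fun z => z ^- L * u z).
Proof.
move=> Lu; elim: L => [|L IH].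
  by apply: L2_eq Lu => t; rewrite expr0 invr1 mul1r.
by apply: L2_eq (L2_mulVz IH) => t; rewrite exprS invfM mulrA.
Qed.

Lemma is_proj_expVz L u : H2 u -> exists g, is_proj (fun z => z ^- L * u z) g.
Proof.
move=> Hu; elim: L => [|L [g IH]].
  exists u; apply: is_proj_eq (is_proj_H2 Hu) => // t.
  by rewrite expr0 invr1 mul1r.
exists (fun z => z^-1 * (g z - fourier g 0)).
apply: is_proj_eq (is_proj_mulVz (L2_expVz L (H2_L2 Hu)) IH) => // t.
by rewrite exprS invfM mulrA.
Qed.

Lemma is_proj_poly L (p : {poly C}) :
  is_proj (fun z => z ^- L * p.[z]) (fun z => (drop_poly L p).[z]).
Proof.
split=> [|h Hh]; first exact: H2_poly.
rewrite (@dotc_eq _ _ (fun z => z ^- L * (take_poly L p).[z]) _ h)//; last first.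
  move=> t; rewrite -{1}(poly_take_drop L p) !hornerE.
  by rewrite mulrDr mulrCA mulVf ?mulr1 ?addrK// expf_neq0// circle_neq0.
rewrite (@dotc_eq _ _ (fun z => \sum_(i < L) p`_i * z ^ (i%:Z - L%:Z)) _ h)//; last first.
  move=> t; rewrite /take_poly horner_poly mulr_sumr; apply: eq_bigr => i _.
  rewrite mulrCA; congr (_ * _).
  by rewrite expfzDr ?circle_neq0// -exprnN mulrC.
have Lh := H2_L2 Hh.
rewrite dotc_suml//; last by move=> i; apply/L2Z/L2_exprz.
rewrite big1// => i _; rewrite dotcZl//; last exact: L2_exprz.
rewrite -dotc_conj//; last exact: L2_exprz.
rewrite -fourierE; case: Hh => _ ->; first by rewrite rmorph0 mulr0.
by rewrite subr_lt0 ltz_nat.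
Qed.

Lemma dotc_poly (p q : {poly C}) :
  dotc (fun z => p.[z]) (fun z => q.[z]) = pdot p q.
Proof.
rewrite (@dotc_eq _ _ (fun z => \sum_(i < size p) p`_i * z ^+ i) _ (fun z => q.[z]))//;
  last by move=> t; rewrite horner_coef.
rewrite dotc_suml; last 2 first.
- by move=> i; apply/L2Z/L2_exp.
- exact: L2_poly.
apply: eq_bigr => i _; rewrite dotcZl; [|exact: L2_exp|exact: L2_poly].
by rewrite -(fourier_poly q i) fourierE dotc_conj//; [exact: L2_poly|exact: L2_exp].
Qed.

End Projection.

(** * Block Toeplitz operators with Laurent polynomial symbols *)

Section Toeplitz.
Variables (R : realType) (n : nat).
Local Notation C := R[i].
Implicit Types (z : C) (f g h u : C -> 'cV[C]_n) (F E : C -> 'M[C]_n).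
Implicit Types (p q : 'cV[{poly C}]_n) (P Q : 'M[{poly C}]_n).

Definition L2vec f := forall i, L2 (fun z => f z i 0).

Definition is_projv u g :=
  forall i, is_proj (fun z => u z i 0) (fun z => g z i 0).

Definition mxeval m k (P : 'M[{poly C}]_(m, k)) z : 'M[C]_(m, k) :=
  map_mx (horner_eval z) P.

Lemma H2vec_L2vec f : H2vec f -> L2vec f.
Proof. by move=> Hf i; exact: H2_L2. Qed.

Lemma is_projv_H2vec u g : is_projv u g -> H2vec g.
Proof. by move=> ug i; have [] := ug i. Qed.

Lemma H2vec_mxeval p : H2vec (mxeval p).
Proof. by move=> i; apply: H2_eq (H2_poly (p i 0)) => t; rewrite mxE. Qed.

Lemma innerE f g : L2vec f -> L2vec g ->
  inner f g = \sum_i dotc (fun z => f z i 0) (fun z => g z i 0).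
Proof.
move=> Lf Lg; rewrite /inner.
elim: (index_enum _) => [|i r IH].
  rewrite big_nil -[RHS](dotc0l (fun=> 0 : C)); apply: circle_integral_eq => t.
  by rewrite big_nil mul0r.
rewrite big_cons -IH -circle_integralD.
- by apply: circle_integral_eq => t; rewrite big_cons.
- exact: L2_mul_conj_integrable.
- elim: r {IH} => [|j r IH].
    apply: circle_integrable_eq (L2_mul_conj_integrable (L2_0 R) (L2_0 R)) => t.
    by rewrite big_nil mul0r.
  apply: circle_integrable_eq
    (circle_integrableD (L2_mul_conj_integrable (Lf j) (Lg j)) IH) => t.
  by rewrite big_cons.
Qed.

Lemma inner_conj f g : L2vec f -> L2vec g -> (inner f g)^* = inner g f.
Proof.
move=> Lf Lg; rewrite !innerE// rmorph_sum; apply: eq_bigr => i _.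
exact: dotc_conj.
Qed.

Lemma innerDl f g h : L2vec f -> L2vec g -> L2vec h ->
  inner (f \+ g) h = inner f h + inner g h.
Proof.
move=> Lf Lg Lh; rewrite !innerE//; last first.
  by move=> i; apply: L2_eq (L2D (Lf i) (Lg i)) => t; rewrite mxE.
rewrite -big_split /=; apply: eq_bigr => i _; rewrite -dotcDl//.
by apply: dotc_eq => // t; rewrite mxE.
Qed.

Lemma innerBl f g h : L2vec f -> L2vec g -> L2vec h ->
  inner (f \- g) h = inner f h - inner g h.
Proof.
move=> Lf Lg Lh; rewrite !innerE//; last first.
  by move=> i; apply: L2_eq (L2B (Lf i) (Lg i)) => t; rewrite !mxE.
rewrite -sumrB; apply: eq_bigr => i _; rewrite -dotcBl//.
by apply: dotc_eq => // t; rewrite !mxE.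
Qed.

Lemma inner_is_projv u g h : L2vec u -> is_projv u g -> H2vec h ->
  inner g h = inner u h.
Proof.
move=> Lu ug Hh; have Lh := H2vec_L2vec Hh.
have Lg := H2vec_L2vec (is_projv_H2vec ug).
by rewrite !innerE//; apply: eq_bigr => i _; exact: is_proj_dotc.
Qed.

Lemma L2vecB f g : L2vec f -> L2vec g -> L2vec (f \- g).
Proof.
by move=> Lf Lg i; apply: L2_eq (L2B (Lf i) (Lg i)) => t; rewrite !mxE.
Qed.

(** Testing against h times a basis vector reduces a vector-valued projection to
    its entries. *)
Lemma is_projvP u g : L2vec u -> H2vec g ->
  (forall h, H2vec h -> inner g h = inner u h) -> is_projv u g.
Proof.
move=> Lu Hg ug i; split; first exact: Hg.
move=> h Hh; have Lg := H2vec_L2vec Hg; have Lh := H2_L2 Hh.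
pose hv z : 'cV[C]_n := h z *: delta_mx i 0.
have Hhv : H2vec hv.
  move=> j; apply: H2_eq (H2Z ((j == i)%:R) Hh) => t.
  by rewrite !mxE andbT mulrC.
have := ug _ Hhv; rewrite !innerE//; [|exact: H2vec_L2vec..].
have E k : L2vec k ->
    \sum_j dotc (fun z => k z j 0) (fun z => hv z j 0) = dotc (fun z => k z i 0) h.
  move=> Lk; rewrite (bigD1 i)//= big1 ?addr0.
    by apply: dotc_eq => // t; rewrite !mxE !eqxx mulr1.
  move=> j /negbTE ji; rewrite -dotc_conj//; last exact: (H2vec_L2vec Hhv).
  rewrite (@dotc_eq _ _ (fun=> 0) _ (fun z => k z j 0))// ?dotc0l ?rmorph0//.
  by move=> t; rewrite !mxE ji mulr0.
by rewrite !E// => e; rewrite dotcBl// e subrr.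
Qed.

Lemma proj_is_projv u : L2vec u -> (forall i, exists v : C -> C, is_proj (fun z => u z i 0) v) ->
  is_projv u (Defs.proj u).
Proof.
move=> Lu ex.
have [H P] : [set g | H2vec g /\ forall h, H2vec h -> inner (u \- g) h = 0] (Defs.proj u).
  apply: xgetPex; have [G GP] := choice ex.
  pose g z : 'cV[C]_n := \col_i G i z.
  have ug : is_projv u g.
    by move=> i; apply: is_proj_eq (GP i) => // t; rewrite mxE.
  have Hg := is_projv_H2vec ug; exists g; split=> // h Hh.
  rewrite innerBl//; [|exact: H2vec_L2vec..].
  by rewrite (inner_is_projv Lu ug Hh) subrr.
apply: is_projvP => // h Hh; apply/esym/eqP; rewrite -subr_eq0 -innerBl ?P//;
  exact: H2vec_L2vec.
Qed.

Definition laurent L P F := forall t : R,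
  F (circle t) = (circle t) ^- L *: mxeval P (circle t).

Lemma H2vec_mxeval_mul P f : H2vec f -> H2vec (fun z => mxeval P z *m f z).
Proof.
move=> Hf i; apply: H2_eq (H2_sum (index_enum _) (fun j => H2_poly_mul (P i j) (Hf j))).
by move=> t; rewrite mxE; apply: eq_bigr => j _; rewrite mxE.
Qed.

Lemma laurent_mulE L P F f i (t : R) : laurent L P F ->
  (F (circle t) *m f (circle t)) i 0 =
  (circle t) ^- L * (mxeval P (circle t) *m f (circle t)) i 0.
Proof. by move=> FP; rewrite FP -scalemxAl mxE. Qed.

Lemma L2vec_laurent L P F f : laurent L P F -> H2vec f -> L2vec (fun z => F z *m f z).
Proof.
move=> FP Hf i; apply: L2_eq (L2_expVz L (H2_L2 (H2vec_mxeval_mul P Hf i))) => t.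
by rewrite (laurent_mulE _ _ _ FP).
Qed.

Lemma toeplitzP L P F f : laurent L P F -> H2vec f ->
  is_projv (fun z => F z *m f z) (toeplitz F f).
Proof.
move=> FP Hf; apply: proj_is_projv; first exact: L2vec_laurent FP Hf.
move=> i; have [g gP] := is_proj_expVz L (H2vec_mxeval_mul P Hf i).
by exists g; apply: is_proj_eq gP => // t; rewrite (laurent_mulE _ _ _ FP).
Qed.

Lemma H2vec_toeplitz L P F f : laurent L P F -> H2vec f -> H2vec (toeplitz F f).
Proof. by move=> FP Hf; apply: is_projv_H2vec (toeplitzP FP Hf). Qed.

Lemma is_projv_laurent_poly L P F p : laurent L P F ->
  is_projv (fun z => F z *m mxeval p z) (mxeval (hi L (P *m p))).
Proof.
move=> FP i; apply: is_proj_eq (is_proj_poly L ((P *m p) i 0)) => t.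
  rewrite (laurent_mulE _ _ _ FP) /mxeval -map_mxM !mxE; congr (_ * _).
by rewrite !mxE.
Qed.

Lemma inner_is_projv_poly u v g k p q : L2vec u -> L2vec v ->
  is_projv u g -> is_projv u (mxeval p) -> is_projv v k -> is_projv v (mxeval q) ->
  inner g k = vdot p q.
Proof.
move=> Lu Lv ug up vk vq.
rewrite innerE; [|exact/H2vec_L2vec/is_projv_H2vec/ug|
  exact/H2vec_L2vec/is_projv_H2vec/vk].
apply: eq_bigr => i _; rewrite (is_proj_dotc_unique (Lu i) (Lv i) (ug i) (up i) (vk i) (vq i)).
by rewrite -dotc_poly; apply: dotc_eq => t; rewrite mxE.
Qed.

Definition adj_circle F E := forall t : R, E (circle t) = (map_mx Num.conj (F (circle t)))^T.

Lemma inner_adj_circle F E f g : adj_circle F E ->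
  inner (fun z => F z *m f z) g = inner f (fun z => E z *m g z).
Proof.
move=> FE; apply: circle_integral_eq => t; rewrite FE.
under eq_bigr do rewrite mxE mulr_suml.
rewrite exchange_big /=; apply: eq_bigr => i _.
rewrite mxE rmorph_sum mulr_sumr; apply: eq_bigr => j _.
by rewrite !mxE rmorphM /= conjCK mulrCA mulrA.
Qed.

(** The adjoint of T_F is T_E when E = F^* on the circle; its existence, which
    makes the chosen value meaningful, is witnessed by the latter. *)
Lemma adjoint_toeplitzP L P F K Q E f :
  laurent L P F -> laurent K Q E -> adj_circle F E -> H2vec f ->
  is_projv (fun z => E z *m f z) (adjoint (toeplitz F) f).
Proof.
move=> FP EQ FE Hf; have Lf := H2vec_L2vec Hf.
have LE := L2vec_laurent EQ Hf.
have adjE h : H2vec h -> inner (toeplitz F h) f = inner h (fun z => E z *m f z).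
  move=> Hh; rewrite (inner_is_projv (L2vec_laurent FP Hh) (toeplitzP FP Hh) Hf).
  exact: inner_adj_circle.
have [H P'] : [set g | H2vec g /\
    forall h, H2vec h -> inner (toeplitz F h) f = inner h g] (adjoint (toeplitz F) f).
  apply: xgetPex; exists (toeplitz E f); split; first exact: H2vec_toeplitz EQ Hf.
  move=> h Hh; have Lh := H2vec_L2vec Hh; rewrite adjE//.
  have LT := H2vec_L2vec (H2vec_toeplitz EQ Hf).
  rewrite -(inner_conj LE Lh) -(inner_conj LT Lh).
  by rewrite (inner_is_projv LE (toeplitzP EQ Hf) Hh).
apply: is_projvP => // h Hh; have Lh := H2vec_L2vec Hh.
have LA := H2vec_L2vec H.
by rewrite -(inner_conj Lh LA) -(inner_conj Lh LE) -P'// adjE.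
Qed.

Section Pair.
Variables (L K : nat) (F E : bool -> C -> 'M[C]_n) (G D : bool -> 'M[{poly C}]_n).
Hypothesis FG : forall b, laurent L (G b) (F b).
Hypothesis ED : forall b, laurent K (D b) (E b).
Hypothesis FE : forall b, adj_circle (F b) (E b).
Let T b := toeplitz (F b).
Let A b := adjoint (T b).

Let HT b f : H2vec f -> H2vec (T b f).
Proof. exact: H2vec_toeplitz (FG b). Qed.

Let PA b f : H2vec f -> is_projv (fun z => E b z *m f z) (A b f).
Proof. exact: adjoint_toeplitzP (FG b) (ED b) (FE b). Qed.

Let HA b f : H2vec f -> H2vec (A b f).
Proof. by move=> Hf; apply: is_projv_H2vec (PA b Hf). Qed.

Let innerTA b f u : H2vec f -> H2vec u -> inner (T b f) u = inner f (A b u).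
Proof.
move=> Hf Hu.
have Lf := H2vec_L2vec Hf; have LA := H2vec_L2vec (HA b Hu).
have LE := L2vec_laurent (ED b) Hu.
rewrite (inner_is_projv (L2vec_laurent (FG b) Hf) (toeplitzP (FG b) Hf) Hu).
rewrite (inner_adj_circle _ _ (FE b)) -(inner_conj LA Lf) -(inner_conj LE Lf).
by rewrite (inner_is_projv LE (PA b Hu) Hf).
Qed.

Lemma inner_commutator a b f u : H2vec f -> H2vec u ->
  inner (commutator (A a) (T b) f) u =
  inner (T b f) (T a u) - inner (A a f) (A b u).
Proof.
move=> Hf Hu; rewrite innerBl; [|exact/H2vec_L2vec/HA/HT|exact/H2vec_L2vec/HT/HA|
  exact: H2vec_L2vec].
congr (_ - _); last by rewrite innerTA//; exact: HA.
have L1 := H2vec_L2vec (HA a (HT b Hf)).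
have L2' := H2vec_L2vec Hu; have L3 := H2vec_L2vec (HT b Hf).
have L4 := H2vec_L2vec (HT a Hu).
by rewrite -(inner_conj L2' L1) -innerTA//; [rewrite inner_conj|exact: HT].
Qed.

Lemma inner_commutator_poly a b p q :
  inner (commutator (A a) (T b) (mxeval p)) (mxeval q) =
  vdot (hi L (G b *m p)) (hi L (G a *m q)) -
  vdot (hi K (D a *m p)) (hi K (D b *m q)).
Proof.
have [Hp Hq] := (H2vec_mxeval p, H2vec_mxeval q).
rewrite inner_commutator//; congr (_ - _).
- apply: inner_is_projv_poly (toeplitzP (FG b) Hp) _ (toeplitzP (FG a) Hq) _.
  + exact: L2vec_laurent (FG b) Hp.
  + exact: L2vec_laurent (FG a) Hq.
  + exact: is_projv_laurent_poly.
  + exact: is_projv_laurent_poly.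
- apply: inner_is_projv_poly (PA a Hp) _ (PA b Hq) _.
  + exact: L2vec_laurent (ED a) Hp.
  + exact: L2vec_laurent (ED b) Hq.
  + exact: is_projv_laurent_poly.
  + exact: is_projv_laurent_poly.
Qed.

Let signed_sum (a b c d a' b' c' d' : C) :
  a - a' + (b - b') + (c - c' + (d - d')) =
  a + b + c + d - (a' + b' + c' + d').
Proof. by ring. Qed.

(** Both sides of each commutator are computed through adjunction as inner
    products of projections, which on polynomials are truncations. *)
Lemma hyponormal_pair_poly :
  hyponormal_pair (T true) (T false) -> forall p1 p2,
  0 <= vdot (hi L (G true *m p1)) (hi L (G true *m p1)) +
       vdot (hi L (G true *m p2)) (hi L (G false *m p1)) +
       vdot (hi L (G false *m p1)) (hi L (G true *m p2)) +
       vdot (hi L (G false *m p2)) (hi L (G false *m p2)) -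
      (vdot (hi K (D true *m p1)) (hi K (D true *m p1)) +
       vdot (hi K (D false *m p2)) (hi K (D true *m p1)) +
       vdot (hi K (D true *m p1)) (hi K (D false *m p2)) +
       vdot (hi K (D false *m p2)) (hi K (D false *m p2))).
Proof.
move=> hT p1 p2; have [H1 H2] := (H2vec_mxeval p1, H2vec_mxeval p2).
have Lc a b f : H2vec f -> L2vec (commutator (A a) (T b) f).
  by move=> Hf; apply: L2vecB; apply: H2vec_L2vec; [exact/HA/HT|exact/HT/HA].
have E1 := etrans
  (innerDl (Lc true true _ H1) (Lc false true _ H2) (H2vec_L2vec H1))
  (congr2 +%R (inner_commutator_poly true true p1 p1)
              (inner_commutator_poly false true p2 p1)).
have E2 := etrans
  (innerDl (Lc true false _ H1) (Lc false false _ H2) (H2vec_L2vec H2))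
  (congr2 +%R (inner_commutator_poly true false p1 p2)
              (inner_commutator_poly false false p2 p2)).
have := hT _ _ H1 H2; rewrite (congr2 +%R E1 E2) => ge0.
by apply: le_trans ge0 _; rewrite signed_sum.
Qed.

End Pair.
End Toeplitz.

(** * Trigonometric polynomials and the theorem *)

Section Symbols.
Variables (R : realType) (n : nat).
Local Notation C := R[i].
Implicit Types (A B : int -> 'M[C]_n).

(** Brings polynomials of different degrees to common bounds L and K: the family
    of coefficients is arbitrary outside the range that is summed. *)
Definition trim m N A (j : int) := if - m%:Z <= j <= N%:Z then A j else 0.

Definition symbol L K A : 'M[{poly C}]_n :=
  \matrix_(i, j) \poly_(t < (L + K).+1) A (t%:Z - L%:Z) i j.

Definition adj_symbol L K A : 'M[{poly C}]_n :=
  \matrix_(i, j) \poly_(t < (L + K).+1) (A (K%:Z - t%:Z) j i)^*.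

Lemma trig_poly_trim m N L K A : (m <= L)%N -> (N <= K)%N ->
  trig_poly m N A =1 trig_poly L K (trim m N A).
Proof.
move=> mL NK z; rewrite /trig_poly.
have le1 : (L - m <= (L + K).+1)%N by rewrite leqW// leq_subLR addnCA leq_addr.
have le2 : (L - m <= (L - m) + (m + N).+1)%N by rewrite leq_addr.
have le3 : ((L - m) + (m + N).+1 <= (L + K).+1)%N.
  by rewrite addnS ltnS addnA subnK// leq_add2l.
rewrite [RHS](@big_cat_nat _ _ _ (L - m)%N)//=.
rewrite [X in _ = X + _]big_nat_cond [X in _ = X + _]big1 ?add0r; last first.
  move=> k /andP[/andP[_ kL] _]; rewrite /trim ifF ?scaler0//.
  by apply/negbTE; rewrite negb_and -!ltNge; lia.
rewrite [RHS](@big_cat_nat _ _ _ ((L - m) + (m + N).+1)%N)//=.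
rewrite [X in _ = _ + X]big_nat_cond [X in _ = _ + X]big1 ?addr0; last first.
  move=> k /andP[/andP[Lk _] _]; rewrite /trim ifF ?scaler0//.
  by apply/negbTE; rewrite negb_and -!ltNge; lia.
rewrite -[X in _ = \sum_(X <= _ < _) _]add0n big_addn addKn.
rewrite [LHS]big_nat_cond [RHS]big_nat_cond; apply: eq_bigr => k /andP[/andP[_ kN] _].
have -> : (k + (L - m))%:Z - L%:Z = k%:Z - m%:Z by lia.
by rewrite /trim ifT//; lia.
Qed.

Lemma trim_bot m N A : trim m N A (- m%:Z) = A (- m%:Z).
Proof. by rewrite /trim ifT//; lia. Qed.

Lemma trim_top m N A : trim m N A N%:Z = A N%:Z.
Proof. by rewrite /trim ifT//; lia. Qed.

Lemma trim_below m N A L : (m < L)%N -> trim m N A (- L%:Z) = 0.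
Proof. by move=> mL; rewrite /trim ifF//; lia. Qed.

Lemma trim_above m N A K : (N < K)%N -> trim m N A K%:Z = 0.
Proof. by move=> NK; rewrite /trim ifF//; lia. Qed.

Lemma coefmx_symbol L K A t : (t <= L + K)%N ->
  coefmx t (symbol L K A) = A (t%:Z - L%:Z).
Proof. by move=> le; apply/matrixP => i j; rewrite !mxE coef_poly ltnS le. Qed.

Lemma coefmx0_adj_symbol L K A :
  coefmx 0 (adj_symbol L K A) = (map_mx Num.conj (A K%:Z))^T.
Proof. by apply/matrixP => i j; rewrite !mxE coef_poly subr0. Qed.

Lemma trig_polyE L K A (t : R) i j : trig_poly L K A (circle t) i j =
  (circle t) ^- L * (symbol L K A i j).[circle t].
Proof.
rewrite /trig_poly summxE big_mkord mxE horner_poly mulr_sumr; apply: eq_bigr => k _.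
by rewrite mxE expfzDr ?circle_neq0// -exprnN mulrA [RHS]mulrC mulrA [_ * A _ _ _]mulrC.
Qed.

Lemma laurent_symbol L K A : laurent L (symbol L K A) (trig_poly L K A).
Proof. by move=> t; apply/matrixP => i j; rewrite trig_polyE !mxE. Qed.

Definition adj_trig L K A z : 'M[C]_n := z ^- K *: mxeval (adj_symbol L K A) z.

Lemma laurent_adj_trig L K A : laurent K (adj_symbol L K A) (adj_trig L K A).
Proof. by []. Qed.

Lemma adj_circle_trig L K A : adj_circle (trig_poly L K A) (adj_trig L K A).
Proof.
move=> t; apply/matrixP => i j; rewrite [RHS]mxE [RHS]mxE trig_polyE !mxE.
rewrite /horner_eval !horner_poly !mulr_sumr rmorph_sum /=.
rewrite (reindex_inj rev_ord_inj) /=; apply: eq_bigr => k _.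
have kLK : (k <= L + K)%N by rewrite -ltnS.
have cX m : (circle t ^+ m)^* = circle t ^- m.
  by rewrite rmorphXn /= -circleV exprVn.
rewrite !rmorphM /=.
rewrite fmorphV /= !cX. rewrite invrK subSS mulrCA [RHS]mulrCA; congr (_^* * _).
  by congr (A _ j i); lia.
by rewrite !exprnN !exprnP -!expfzDr ?circle_neq0//; congr (_ ^ _); lia.
Qed.

(** Both sides are the sum of the squared moduli of all entries of all
    coefficients: a matrix and its adjoint have the same Frobenius norm. *)
Lemma trace_symbol L K A :
  \sum_s vdot (symbol L K A *m delta_mx s 0) (symbol L K A *m delta_mx s 0) =
  \sum_s vdot (adj_symbol L K A *m delta_mx s 0) (adj_symbol L K A *m delta_mx s 0).
Proof.
have col_entry (P : 'M[{poly C}]_n) s r : (P *m delta_mx s (0 : 'I_1)) r 0 = P r s.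
  by rewrite -colE mxE.
rewrite /vdot [RHS]exchange_big; apply: eq_bigr => s _; apply: eq_bigr => r _.
rewrite !col_entry !mxE !(pdotE _ (size_poly _ _)).
rewrite (reindex_inj rev_ord_inj) /=; apply: eq_bigr => k _.
rewrite !coef_poly ltn_ord subSS ltnS leq_subr conjCK mulrC.
have kLK : (k <= L + K)%N by rewrite -ltnS.
by have -> : (L + K - k)%:Z - L%:Z = K%:Z - k%:Z by lia.
Qed.

Lemma H2mx_laurent L (P : 'M[{poly C}]_n) (F : C -> 'M[C]_n) : laurent L P F ->
  (forall k, (k < L)%N -> coefmx k P = 0) -> H2mx F.
Proof.
move=> FP P0 i j.
have [Q PQ _] := coefmx_factor P0.
apply: H2_eq (H2_poly (Q i j)) => t.
by rewrite FP PQ !mxE /horner_eval hornerM hornerXn mulrA mulVf ?mul1r// expf_neq0// circle_neq0.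
Qed.

Lemma laurent_sub L P Q (F E : C -> 'M[C]_n) c : laurent L P F -> laurent L Q E ->
  laurent L (P - c%:P *: Q) (fun z => F z - c%:M *m E z).
Proof.
move=> FP EQ t; rewrite FP EQ mul_scalar_mx; apply/matrixP => i j.
by rewrite !mxE /horner_eval hornerD hornerN hornerM hornerC; ring.
Qed.

Lemma coefmx_sub k (P Q : 'M[{poly C}]_n) c :
  coefmx k (P - c%:P *: Q) = coefmx k P - c *: coefmx k Q.
Proof. by apply/matrixP => i j; rewrite !mxE coefB coefCM. Qed.

Lemma unitmx_adj (A : 'M[C]_n) : ((map_mx Num.conj A)^T \in unitmx) = (A \in unitmx).
Proof. by rewrite unitmx_tr map_unitmx. Qed.

Lemma hyponormal_pair_hankel_ineq m N l M L K A B :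
  (m <= L)%N -> (N <= K)%N -> (l <= L)%N -> (M <= K)%N ->
  hyponormal_pair (toeplitz (trig_poly m N A)) (toeplitz (trig_poly l M B)) ->
  hankel_ineq L K (symbol L K (trim m N A)) (symbol L K (trim l M B))
    (adj_symbol L K (trim m N A)) (adj_symbol L K (trim l M B)).
Proof.
move=> mL NK lL MK.
rewrite (funext (trig_poly_trim A mL NK)) (funext (trig_poly_trim B lL MK)) => hT.
apply: toeplitz_ge0_hankel_ineq; [|exact: trace_symbol..].
pose S b := if b then trim m N A else trim l M B.
exact: (hyponormal_pair_poly (F := fun b => trig_poly L K (S b))
  (fun b => laurent_symbol L K (S b)) (fun b => laurent_adj_trig L K (S b))
  (fun b => adj_circle_trig L K (S b)) hT).
Qed.

End Symbols.

Theorem corollary9p22 (R : realType) (n m N l M : nat)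
  (A B : int -> 'M[R[i]]_n)
  (hl : (0 < l)%N)
  (hA_m : A (- m%:Z) \in unitmx) (hA_N : A N%:Z \in unitmx)
  (hB_l : B (- l%:Z) \in unitmx) (hB_M : B M%:Z \in unitmx)
  (hA_diag : is_scalar_mx (A (- m%:Z)))
  (hB_diag : is_scalar_mx (B (- l%:Z)))
  (hT : hyponormal_pair (toeplitz (trig_poly m N A))
                        (toeplitz (trig_poly l M B))) :
  exists Lambda : 'M[R[i]]_n,
    H2mx (fun z => trig_poly m N A z - Lambda *m trig_poly l M B z).
Proof.
case: n A B hA_m hA_N hB_l hB_M hA_diag hB_diag hT => [|n] A B
  hA_m hA_N hB_l hB_M hA_diag hB_diag hT; first by exists 0; case.
(* Common bounds, so that both symbols are z^-L times polynomials. *)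
pose L := maxn m l; pose K := maxn N M.
have ineq := hyponormal_pair_hankel_ineq (leq_maxl m l) (leq_maxl N M)
  (leq_maxr m l) (leq_maxr N M) hT.
rewrite -/L -/K in ineq.
pose A' := trim m N A; pose B' := trim l M B; rewrite -/A' -/B' in ineq.
have D0 (b : int -> 'M[R[i]]_n.+1) : coefmx 0 (adj_symbol L K b) = (map_mx Num.conj (b K%:Z))^T.
  exact: coefmx0_adj_symbol.
have G0 (b : int -> 'M[R[i]]_n.+1) : coefmx 0 (symbol L K b) = b (- L%:Z).
  by rewrite coefmx_symbol// sub0r.
have not_unit0 : (0 : 'M[R[i]]_n.+1) \notin unitmx by rewrite unitmxE det0 unitr0.
(* The degree K is attained by B, or by A alone; in the latter case subtracting
   a multiple of B does not affect the coefficient of z^K. *)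
have D_unit : coefmx 0 (adj_symbol L K B') = 0 /\
    coefmx 0 (adj_symbol L K A') \in unitmx \/
  coefmx 0 (adj_symbol L K B') \in unitmx.
  rewrite !D0 !unitmx_adj; have [NM|MN] := leqP N M.
    by right; rewrite /K (maxn_idPr NM) /B' trim_top.
  by left; rewrite /K (maxn_idPl (ltnW MN)) /A' /B' trim_top trim_above// map_mx0 trmx0.
have [ml|lm] := leqP m l; last first.
  (* With the roles exchanged, Psi would be analytic, against B_(-l) invertible
     and l > 0. *)
  have LE : L = m by apply/maxn_idPl/ltnW.
  have A'L : A' (- L%:Z) = A (- m%:Z) by rewrite LE /A' trim_bot.
  have B'0 : forall k, (k < L)%N -> coefmx k (symbol L K B') = 0.
    apply: (hankel_ineq_coef_eq0 (hankel_ineqC ineq)).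
    - by rewrite G0 LE /B' trim_below.
    - rewrite G0 A'L; exact: hA_m.
    - by case: D_unit => [[_]|]; [right|left].
  have lt : (m - l < L)%N by rewrite LE ltn_subrL hl (leq_ltn_trans _ lm).
  have := B'0 _ lt; rewrite coefmx_symbol ?(leq_trans (ltnW lt)) ?leq_addr//.
  rewrite LE -subzn ?(ltnW lm)// addrAC subrr add0r /B' trim_bot => B0.
  by move: hB_l; rewrite B0 (negPf not_unit0).
have LE : L = l by apply/maxn_idPr.
have B'L : B' (- L%:Z) = B (- l%:Z) by rewrite LE /B' trim_bot.
have [b bE] := is_scalar_mxP hB_diag.
have b0 : b != 0.
  by apply: contraTneq hB_l => b0; rewrite bE b0 raddf0.
(* If m < l this coefficient is zero, still a scalar matrix. *)
have [a aE] : exists a, A' (- L%:Z) = a%:M.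
  have [ml'|ml'] := eqVneq m l.
    have [a aE] := is_scalar_mxP hA_diag.
    by exists a; rewrite -aE LE -ml' /A' trim_bot.
  by exists 0; rewrite raddf0 LE /A' trim_below// ltn_neqAle ml'.
(* This choice cancels the coefficient of z^-L. *)
exists (a / b)%:M.
apply: (H2mx_laurent (L := L) (P := symbol L K A' - (a / b)%:P *: symbol L K B')).
  move=> t; rewrite (trig_poly_trim A (leq_maxl m l) (leq_maxl N M)).
  rewrite (trig_poly_trim B (leq_maxr m l) (leq_maxr N M)).
  exact: (laurent_sub (a / b) (laurent_symbol L K A') (laurent_symbol L K B')).
apply: (hankel_ineq_coef_eq0 (hankel_ineq_sub (a / b) ineq)).
- by rewrite coefmx_sub !G0 aE B'L bE scale_scalar_mx divfK// subrr.
- rewrite G0 B'L; exact: hB_l.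
- case: D_unit => [[DB DA]|DB]; last by right.
  by left; rewrite coefmx_sub DB scaler0 subr0.
Qed.
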